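(* Let $A$ be a Hopf algebra with a bicovariant first-order differential calculus $(\Gamma,d)$. Let $V=t_i\diamond b^i$ ($b^i\in A$) be a vectorfield, $a\in A$, $\lambda\in\mathbf C$, and let $\vartheta,\vartheta'$ be covariant tensorfields, i.e. elements of $\Gamma^{\otimes}=\bigoplus_n\Gamma^{\otimes n}$ (in property (d$'$) $\vartheta,\vartheta'$ are homogeneous exterior forms). The contraction operator $i_V$ satisfies: (a$'$) $i_V(\vartheta)=i_{t_j}(\vartheta)\,b^j$; (b$'$) $i_V(a)=0$; (c$'$) $i_V(\omega^j)=b^j$; (d$'$) $i_V(\vartheta\wedge\vartheta')=i_{t_j}(\vartheta)\wedge(f^j{}_i*\vartheta')\,b^i+(-1)^{\deg\vartheta}\,\vartheta\wedge i_V(\vartheta')$; (e$'$) $i_V(a\vartheta+\vartheta')=a\,i_V(\vartheta)+i_V(\vartheta')$; (f$'$) $i_V(\vartheta a)=i_{t_j}(\vartheta)\,(f^j{}_i*a)\,b^i$; (g$'$) $i_{\lambda V}=\lambda\, i_V$.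
   Context: Conventions: repeated indices are summed. $A$ is a Hopf algebra over $\mathbf{C}$ with coproduct $\Delta$ (written $\Delta(a)=a_1\otimes a_2$), counit $\varepsilon$ and invertible antipode $\kappa$. A bicovariant first-order differential calculus $(\Gamma,d)$ is an $A$-bimodule $\Gamma$ and a linear map $d:A\to\Gamma$ with $d(ab)=(da)b+a\,db$, such that every element of $\Gamma$ is a finite sum $\sum_k a_k\,db_k$, and such that the maps $\Delta_\Gamma:\Gamma\to A\otimes\Gamma$, $\Delta_\Gamma(a\,db)=\Delta(a)(id\otimes d)\Delta(b)$, and ${}_\Gamma\Delta:\Gamma\to\Gamma\otimes A$, ${}_\Gamma\Delta(a\,db)=\Delta(a)(d\otimes id)\Delta(b)$, are well defined. The space of left-invariant elements ($\Delta_\Gamma(\omega)=I\otimes\omega$) is assumed to have a finite basis $\{\omega^i\}$; $\Gamma$ is free on it both as left and as right $A$-module. The functionals $f^i{}_j:A\to\mathbf C$, the elements $M_j{}^i\in A$ and the functionals $\chi_i:A\to\mathbf C$ are defined by $$\omega^i b=(f^i{}_j*b)\,\omega^j,\qquad {}_\Gamma\Delta(\omega^i)=\omega^j\otimes M_j{}^i,\qquad da=(\chi_i*a)\,\omega^i,$$ where $\psi*a=(id\otimes\psi)\Delta(a)$ for a functional $\psi$. Tensor products of copies of $\Gamma$ are over $A$; $\Gamma^{\otimes 0}=A$. The right coaction on $\Gamma^{\otimes n}$ is ${}_\Gamma\Delta(\rho\otimes\rho'\otimes\cdots)=\rho_1\otimes\rho'_1\otimes\cdots\otimes\rho_2\rho'_2\cdots$,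 where ${}_\Gamma\Delta(\rho)=\rho_1\otimes\rho_2$; on $\Gamma^{\otimes0}=A$ it is $\Delta$. For a functional $\psi$ and $\tau\in\Gamma^{\otimes n}$, $\psi*\tau=(id\otimes\psi)\,{}_\Gamma\Delta(\tau)$. Exterior forms: set $\Lambda^{ij}{}_{kl}=f^i{}_l(M_k{}^j)$. Wedge products are identified with tensors: $\omega^{i_1}\wedge\cdots\wedge\omega^{i_n}=W^{i_1\ldots i_n}{}_{j_1\ldots j_n}\,\omega^{j_1}\otimes\cdots\otimes\omega^{j_n}$, where as matrices (upper indices = rows, lower indices = columns) $W_1=1$, $W_{1\ldots n}=\mathcal I_{1\ldots n}W_{1\ldots n-1}$, $\mathcal I_{1\ldots n}=1+\sum_{k=1}^{n-1}(-1)^k\Lambda_{n-k,n-k+1}\cdots\Lambda_{n-1,n}$, and $\Lambda_{m,m+1}$ is $\Lambda$ acting on the $m$-th and $(m+1)$-th factors. $\Gamma^{\wedge n}\subset\Gamma^{\otimes n}$ is the left $A$-span of these; $\Gamma^{\wedge 0}=A$. Vectorfields: $t_i=\chi_i*:A\to A$; for $b^i\in A$, $V=t_i\diamond b^i$ is the map $V(a)=t_i(a)b^i$; the coefficients $b^i$ are uniquely determined by $V$. Contraction operator: for $\vartheta=a_{i_n\ldots i_1}\omega^{i_n}\otimes\cdots\otimes\omega^{i_1}\in\Gamma^{\otimes n}$ with $n\ge1$, $i_V(\vartheta)=(-1)^{n-1}a_{i_n\ldots i_1}\,\omega^{i_n}\otimes\cdots\otimes\omega^{i_2}\,b^{i_1}$,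 and $i_V(a)=0$ on $A$; extended linearly to $\Gamma^\otimes$. *)

(* Defs.v *)
From HB Require Import structures.
From mathcomp Require Import all_boot all_order all_algebra.
From mathcomp Require Import generic_quotient.
From mathcomp Require Import boolp classical_sets functions cardinality fsbigop.
From mathcomp Require Import reals complex.

Set Implicit Arguments.
Unset Strict Implicit.
Unset Printing Implicit Defensive.

Import GRing.Theory.
Local Open Scope ring_scope.
Local Open Scope quotient_scope.

Section Balanced.
Variables (S : Type) (M N : zmodType) (r : M -> S -> M) (l : S -> N -> N).

Definition balanced (W : zmodType) (f : M -> N -> W) : Prop :=
  [/\ forall x x' y, f (x + x') y = f x y + f x' y,
      forall x y y', f x (y + y') = f x y + f x y'
    & forall x s y, f (r x s) y = f x (l s y)].

Definition tens_sum (W : zmodType) (f : M -> N -> W) (s : seq (M * N)) : W :=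
  \sum_(p <- s) f p.1 p.2.

(* Two formal sums of pairs are identified when no balanced map separates
   them; this is the congruence generated by biadditivity and
   (x s, y) ~ (x, s y). *)
Definition tens_rel (s t : seq (M * N)) : bool :=
  `[< forall (W : zmodType) (f : M -> N -> W),
        balanced f -> tens_sum f s = tens_sum f t >].

Lemma tens_rel_refl : reflexive tens_rel.
Proof. by move=> s; apply/asboolP. Qed.

Lemma tens_rel_sym : symmetric tens_rel.
Proof.
by move=> s t; apply/asboolP/asboolP => H W f /H ->.
Qed.

Lemma tens_rel_trans : transitive tens_rel.
Proof.
move=> t s u /asboolP H1 /asboolP H2; apply/asboolP => W f bf.
by rewrite H1 // H2.
Qed.

Canonical tens_equiv :=
  EquivRel tens_rel tens_rel_refl tens_rel_sym tens_rel_trans.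

Definition tensor := {eq_quot tens_equiv}.

HB.instance Definition _ := Choice.on tensor.
HB.instance Definition _ := EqQuotient.on tensor.

Definition pure (x : M) (y : N) : tensor := \pi_tensor [:: (x, y)].

(* The map x (x) y |-> f x y; it depends on the chosen representative of t
   only when f is not balanced (see tens_lift_pi). *)
Definition tens_lift (W : zmodType) (f : M -> N -> W) (t : tensor) : W :=
  tens_sum f (repr t).

Lemma tens_lift_pi (W : zmodType) (f : M -> N -> W) s :
  balanced f -> tens_lift f (\pi_tensor s) = tens_sum f s.
Proof.
move=> bf; rewrite /tens_lift.
have /eqP : repr (\pi_tensor s) = s %[mod tensor] by rewrite reprK.
by rewrite eqmodE => /asboolP; apply.
Qed.

Lemma tens_lift_pure (W : zmodType) (f : M -> N -> W) x y :
  balanced f -> tens_lift f (pure x y) = f x y.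
Proof. by move=> bf; rewrite tens_lift_pi // /tens_sum big_seq1. Qed.

Lemma tens_ext (t u : tensor) :
  (forall (W : zmodType) (f : M -> N -> W),
     balanced f -> tens_lift f t = tens_lift f u) -> t = u.
Proof.
move=> H; rewrite -[t]reprK -[u]reprK; apply/eqP; rewrite eqmodE.
by apply/asboolP => W f /H.
Qed.

Definition tens_add (t u : tensor) : tensor := \pi_tensor (repr t ++ repr u).
Definition tens_opp (t : tensor) : tensor :=
  \pi_tensor [seq (- p.1, p.2) | p <- repr t].
Definition tens_zero : tensor := \pi_tensor [::].

Lemma balancedN (W : zmodType) (f : M -> N -> W) x y :
  balanced f -> f (- x) y = - f x y.
Proof.
case=> fD _ _; have f0 : f 0 y = 0.
  by apply: (addrI (f 0 y)); rewrite -fD !addr0.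
by apply/eqP; rewrite -addr_eq0 -fD addNr f0.
Qed.

Lemma tens_lift_add W f t u : balanced f ->
  @tens_lift W f (tens_add t u) = tens_lift f t + tens_lift f u.
Proof. by move=> bf; rewrite tens_lift_pi // [LHS]big_cat. Qed.

Lemma tens_lift_opp W f t : balanced f ->
  @tens_lift W f (tens_opp t) = - tens_lift f t.
Proof.
move=> bf; rewrite tens_lift_pi // /tens_sum big_map -sumrN.
by apply: eq_bigr => p _; apply: balancedN.
Qed.

Lemma tens_lift_zero W f : balanced f -> @tens_lift W f tens_zero = 0.
Proof. by move=> bf; rewrite tens_lift_pi // /tens_sum big_nil. Qed.

Lemma tens_addA : associative tens_add.
Proof. by move=> t u v; apply: tens_ext => W f bf; rewrite !tens_lift_add ?addrA. Qed.
Lemma tens_addC : commutative tens_add.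
Proof. by move=> t u; apply: tens_ext => W f bf; rewrite !tens_lift_add // addrC. Qed.
Lemma tens_add0 : left_id tens_zero tens_add.
Proof.
by move=> t; apply: tens_ext => W f bf;
   rewrite tens_lift_add // tens_lift_zero // add0r.
Qed.
Lemma tens_addN : left_inverse tens_zero tens_opp tens_add.
Proof.
by move=> t; apply: tens_ext => W f bf;
   rewrite tens_lift_add // tens_lift_zero // tens_lift_opp // addNr.
Qed.

HB.instance Definition _ :=
  GRing.isZmodule.Build tensor tens_addA tens_addC tens_add0 tens_addN.

Lemma tens_liftD W f t u : balanced f ->
  @tens_lift W f (t + u) = tens_lift f t + tens_lift f u.
Proof. exact: tens_lift_add. Qed.

Lemma tens_lift0 W f : balanced f -> @tens_lift W f 0 = 0.
Proof. exact: tens_lift_zero. Qed.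

Lemma balanced_pure : balanced pure.
Proof.
split=> [x x' y|x y y'|x s y]; apply: tens_ext => W f bf;
  rewrite ?tens_liftD ?tens_lift_pure //; by case: bf.
Qed.

Lemma tens_sum_pure (t : tensor) : t = \sum_(p <- repr t) pure p.1 p.2.
Proof.
have bs s : \sum_(p <- s) pure p.1 p.2 = \pi_tensor s.
  apply: tens_ext => W f bf; rewrite tens_lift_pi // /tens_sum.
  elim: s => [|p s IH]; first by rewrite !big_nil tens_lift0.
  by rewrite !big_cons tens_liftD // IH tens_lift_pure.
by rewrite bs reprK.
Qed.

Lemma tens_ind (P : tensor -> Prop) : P 0 -> (forall t u, P t -> P u -> P (t + u)) ->
  (forall x y, P (pure x y)) -> forall t, P t.
Proof.
by move=> P0 PD Pp t; rewrite [t]tens_sum_pure; apply: big_ind.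
Qed.

Lemma tens_lift_eq W f g t : f =2 g -> @tens_lift W f t = tens_lift g t.
Proof. by move=> fg; apply: eq_bigr => p _; rewrite fg. Qed.

End Balanced.

Section TensK.
Variable K : fieldType.

Definition tensK (M N : lmodType K) : Type :=
  tensor (fun (x : M) (k : K) => k *: x) (fun (k : K) (y : N) => k *: y).

Variables M N : lmodType K.
Local Notation T := (tensK M N).

HB.instance Definition _ := GRing.Zmodule.on T.

Definition tmk (x : M) (y : N) : T := pure _ _ x y.
Definition tlift (W : zmodType) (f : M -> N -> W) (t : T) : W := tens_lift f t.

Definition tensK_scale (k : K) (t : T) : T := tlift (fun x y => tmk (k *: x) y) t.

Lemma tensK_scale_bal k : balanced (fun (x : M) (k : K) => k *: x)
  (fun (k : K) (y : N) => k *: y) (fun x y => tmk (k *: x) y).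
Proof.
have [D1 D2 B] := balanced_pure (fun (x : M) (k : K) => k *: x)
  (fun (k : K) (y : N) => k *: y).
split=> [x x' y|x y y'|x s y]; rewrite /tmk.
- by rewrite scalerDr D1.
- by rewrite D2.
- by rewrite -B !scalerA mulrC.
Qed.

Lemma tensK_scaleD k t u : tensK_scale k (t + u) = tensK_scale k t + tensK_scale k u.
Proof. exact/tens_liftD/tensK_scale_bal. Qed.
Lemma tensK_scale0 k : tensK_scale k 0 = 0.
Proof. exact/tens_lift0/tensK_scale_bal. Qed.
Lemma tensK_scaleE k x y : tensK_scale k (tmk x y) = tmk (k *: x) y.
Proof. exact/tens_lift_pure/tensK_scale_bal. Qed.

Lemma tensK_scaleA a b t : tensK_scale a (tensK_scale b t) = tensK_scale (a * b) t.
Proof.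
elim/tens_ind: t => [|t u IH1 IH2|x y]; first by rewrite !tensK_scale0.
  by rewrite !tensK_scaleD IH1 IH2.
by rewrite !tensK_scaleE scalerA.
Qed.
Lemma tensK_scale1 : left_id 1 tensK_scale.
Proof.
move=> t; elim/tens_ind: t => [|t u IH1 IH2|x y]; first by rewrite tensK_scale0.
  by rewrite tensK_scaleD IH1 IH2.
by rewrite tensK_scaleE scale1r.
Qed.
Lemma tensK_scaleDr : right_distributive tensK_scale +%R.
Proof. exact: tensK_scaleD. Qed.
Lemma tensK_scaleDl t : {morph tensK_scale^~ t : a b / a + b}.
Proof.
move=> a b; elim/tens_ind: t => [|t u IH1 IH2|x y].
- by rewrite !tensK_scale0 addr0.
- by rewrite !tensK_scaleD IH1 IH2 addrACA.
- rewrite !tensK_scaleE scalerDl.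
  by have [D1 _ _] := balanced_pure (fun (x : M) (k : K) => k *: x)
    (fun (k : K) (y : N) => k *: y); rewrite /tmk D1.
Qed.

HB.instance Definition _ := GRing.Zmodule_isLmodule.Build K T
  tensK_scaleA tensK_scale1 tensK_scaleDr tensK_scaleDl.

End TensK.

Notation "x \ox y" := (tmk x y) (at level 40, left associativity) : ring_scope.

Section TensKMaps.
Variable K : fieldType.

Definition tmap (M N M' N' : lmodType K) (f : M -> M') (g : N -> N') :
    tensK M N -> tensK M' N' :=
  tlift (fun x y => f x \ox g y).

Definition tmap2 (M N M' N' P Q : lmodType K)
    (f : M -> M' -> P) (g : N -> N' -> Q) (t : tensK M N) (u : tensK M' N') :
    tensK P Q :=
  tlift (fun x y => tlift (fun x' y' => f x x' \ox g y y') u) t.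

Definition tassoc (M N P : lmodType K) : tensK (tensK M N) P -> tensK M (tensK N P) :=
  tlift (fun t z => tlift (fun x y => x \ox (y \ox z)) t).

(* (id (x) psi) : M (x) N -> M (x) K = M *)
Definition slice (M N : lmodType K) (psi : N -> K) : tensK M N -> M :=
  tlift (fun x y => psi y *: x).

End TensKMaps.

HB.mixin Record isHopf (K : fieldType) A of GRing.Algebra K A := {
  coprod : A -> tensK A A;
  counit : A -> K;
  antipode : A -> A;
  coprod_linear : linear coprod;
  coprod1 : coprod 1 = 1 \ox 1;
  coprodM : forall a b, coprod (a * b) = tmap2 *%R *%R (coprod a) (coprod b);
  coprodA : forall a,
    tassoc (tmap coprod id (coprod a)) = tmap id coprod (coprod a);
  counit_scalar : scalar counit;
  counit1 : counit 1 = 1;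
  counitM : forall a b, counit (a * b) = counit a * counit b;
  counitl : forall a, tlift (fun x y => counit x *: y) (coprod a) = a;
  counitr : forall a, tlift (fun x y => counit y *: x) (coprod a) = a;
  antipode_linear : linear antipode;
  antipode_bij : bijective antipode;
  antipodel : forall a,
    tlift (fun x y => antipode x * y) (coprod a) = (counit a)%:A;
  antipoder : forall a,
    tlift (fun x y => x * antipode y) (coprod a) = (counit a)%:A
}.

#[short(type="hopfAlgType")]
HB.structure Definition HopfAlgebra (K : fieldType) :=
  { A of GRing.Algebra K A & isHopf K A }.

HB.mixin Record isBimodule (K : fieldType) (A : algType K) M
    of GRing.Lmodule K M := {
  lact : A -> M -> M;
  ract : M -> A -> M;
  lactDl : forall a b x, lact (a + b) x = lact a x + lact b x;
  lactDr : forall a x y, lact a (x + y) = lact a x + lact a y;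
  lactA : forall a b x, lact a (lact b x) = lact (a * b) x;
  lactK : forall k x, lact k%:A x = k *: x;
  ractDl : forall x y a, ract (x + y) a = ract x a + ract y a;
  ractDr : forall x a b, ract x (a + b) = ract x a + ract x b;
  ractA : forall x a b, ract (ract x a) b = ract x (a * b);
  ractK : forall k x, ract x k%:A = k *: x;
  lractA : forall a x b, ract (lact a x) b = lact a (ract x b)
}.

#[short(type="bimodType")]
HB.structure Definition Bimodule (K : fieldType) (A : algType K) :=
  { M of GRing.Lmodule K M & isBimodule K A M }.

Notation "a >* x" := (lact a x) (at level 40, left associativity) : ring_scope.
Notation "x *< a" := (ract x a) (at level 40, left associativity) : ring_scope.

Section BimoduleTheory.
Variables (K : fieldType) (A : algType K) (M : bimodType A).
Implicit Types (k : K) (a : A) (x : M).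

Lemma lactZr a k x : a >* (k *: x) = k *: (a >* x).
Proof. by rewrite -!lactK !lactA mulr_algr mulr_algl. Qed.
Lemma ractZl a k x : (k *: x) *< a = k *: (x *< a).
Proof. by rewrite -!lactK lractA. Qed.
Lemma lactZl a k x : (k *: a) >* x = k *: (a >* x).
Proof. by rewrite -[in RHS]lactK lactA mulr_algl. Qed.
Lemma ractZr a k x : x *< (k *: a) = k *: (x *< a).
Proof. by rewrite -[in RHS]ractK ractA mulr_algr. Qed.
Lemma lactr0 a : a >* (0 : M) = 0.
Proof. by apply: (addrI (a >* 0)); rewrite -lactDr !addr0. Qed.
Lemma ractl0 a : (0 : M) *< a = 0.
Proof. by apply: (addrI ((0 : M) *< a)); rewrite -ractDl !addr0. Qed.

End BimoduleTheory.

Definition regular_bimod (K : fieldType) (A : algType K) : Type := A.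

Section RegularBimod.
Variables (K : fieldType) (A : algType K).
HB.instance Definition _ := GRing.Lmodule.on (regular_bimod A).

Local Notation B := (regular_bimod A).
Local Notation mul := (fun a b : A => a * b).

Fact reg_Dl (a b : A) (x : B) : mul (a + b) x = mul a x + mul b x :> B.
Proof. exact: mulrDl. Qed.
Fact reg_Dr (a : A) (x y : B) : mul a (x + y) = mul a x + mul a y :> B.
Proof. exact: mulrDr. Qed.
Fact reg_A (a b : A) (x : B) : mul a (mul b x) = mul (a * b) x :> B.
Proof. exact: mulrA. Qed.
Fact reg_A' (x : B) (a b : A) : mul (mul x a) b = mul x (a * b) :> B.
Proof. exact: esym (mulrA _ _ _). Qed.
Fact reg_K (k : K) (x : B) : mul k%:A x = k *: x :> B.
Proof. exact: mulr_algl. Qed.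
Fact reg_K' (k : K) (x : B) : mul x k%:A = k *: x :> B.
Proof. exact: mulr_algr. Qed.
Fact reg_lrA (a : A) (x : B) (b : A) : mul (mul a x) b = mul a (mul x b) :> B.
Proof. exact: esym (mulrA _ _ _). Qed.

HB.instance Definition _ := isBimodule.Build K A B
  reg_Dl reg_Dr reg_A reg_K (fun x y a => reg_Dl x y a)
  (fun x a b => reg_Dr x a b) reg_A' reg_K' reg_lrA.
End RegularBimod.

Section TensA.
Variables (K : fieldType) (A : algType K).

Definition tensA (M N : bimodType A) : Type :=
  tensor (fun (x : M) (a : A) => x *< a) (fun (a : A) (y : N) => a >* y).

Variables M N : bimodType A.
Local Notation T := (tensA M N).
Local Notation bal := (balanced (fun (x : M) (a : A) => x *< a)
  (fun (a : A) (y : N) => a >* y)).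

HB.instance Definition _ := GRing.Zmodule.on T.

Definition tmkA (x : M) (y : N) : T := pure _ _ x y.
Definition tliftA (W : zmodType) (f : M -> N -> W) (t : T) : W := tens_lift f t.

Definition tensA_scale (k : K) (t : T) : T :=
  tliftA (fun x y => tmkA (k *: x) y) t.
Definition tensA_lact (a : A) (t : T) : T :=
  tliftA (fun x y => tmkA (a >* x) y) t.
Definition tensA_ract (t : T) (a : A) : T :=
  tliftA (fun x y => tmkA x (y *< a)) t.

Lemma tmkADl x x' y : tmkA (x + x') y = tmkA x y + tmkA x' y.
Proof. by have [D1 _ _] := balanced_pure (fun (x : M) (a : A) => x *< a)
  (fun (a : A) (y : N) => a >* y); apply: D1. Qed.
Lemma tmkADr x y y' : tmkA x (y + y') = tmkA x y + tmkA x y'.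
Proof. by have [_ D2 _] := balanced_pure (fun (x : M) (a : A) => x *< a)
  (fun (a : A) (y : N) => a >* y); apply: D2. Qed.
Lemma tmkA_bal x a y : tmkA (x *< a) y = tmkA x (a >* y).
Proof. by have [_ _ B] := balanced_pure (fun (x : M) (a : A) => x *< a)
  (fun (a : A) (y : N) => a >* y); apply: B. Qed.

Lemma tensA_scale_bal k : bal (fun x y => tmkA (k *: x) y).
Proof.
split=> [x x' y|x y y'|x s y].
- by rewrite scalerDr tmkADl.
- by rewrite tmkADr.
- by rewrite -ractZl tmkA_bal.
Qed.
Lemma tensA_lact_bal a : bal (fun x y => tmkA (a >* x) y).
Proof.
split=> [x x' y|x y y'|x s y].
- by rewrite lactDr tmkADl.
- by rewrite tmkADr.
- by rewrite -lractA tmkA_bal.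
Qed.
Lemma tensA_ract_bal a : bal (fun x y => tmkA x (y *< a)).
Proof.
split=> [x x' y|x y y'|x s y].
- by rewrite tmkADl.
- by rewrite ractDl tmkADr.
- by rewrite tmkA_bal lractA.
Qed.

Lemma tensA_scaleD k t u : tensA_scale k (t + u) = tensA_scale k t + tensA_scale k u.
Proof. exact/tens_liftD/tensA_scale_bal. Qed.
Lemma tensA_scale0 k : tensA_scale k 0 = 0.
Proof. exact/tens_lift0/tensA_scale_bal. Qed.
Lemma tensA_scaleE k x y : tensA_scale k (tmkA x y) = tmkA (k *: x) y.
Proof. exact/tens_lift_pure/tensA_scale_bal. Qed.
Lemma tensA_lactD k t u : tensA_lact k (t + u) = tensA_lact k t + tensA_lact k u.
Proof. exact/tens_liftD/tensA_lact_bal. Qed.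
Lemma tensA_lact0 k : tensA_lact k 0 = 0.
Proof. exact/tens_lift0/tensA_lact_bal. Qed.
Lemma tensA_lactE k x y : tensA_lact k (tmkA x y) = tmkA (k >* x) y.
Proof. exact/tens_lift_pure/tensA_lact_bal. Qed.
Lemma tensA_ractD t u a : tensA_ract (t + u) a = tensA_ract t a + tensA_ract u a.
Proof. exact/tens_liftD/tensA_ract_bal. Qed.
Lemma tensA_ract0 a : tensA_ract 0 a = 0.
Proof. exact/tens_lift0/tensA_ract_bal. Qed.
Lemma tensA_ractE x y a : tensA_ract (tmkA x y) a = tmkA x (y *< a).
Proof. exact/tens_lift_pure/tensA_ract_bal. Qed.

Lemma tensA_scaleA a b t : tensA_scale a (tensA_scale b t) = tensA_scale (a * b) t.
Proof.
elim/tens_ind: t => [|t u IH1 IH2|x y]; first by rewrite !tensA_scale0.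
  by rewrite !tensA_scaleD IH1 IH2.
by rewrite !tensA_scaleE scalerA.
Qed.
Lemma tensA_scale1 : left_id 1 tensA_scale.
Proof.
move=> t; elim/tens_ind: t => [|t u IH1 IH2|x y]; first by rewrite tensA_scale0.
  by rewrite tensA_scaleD IH1 IH2.
by rewrite tensA_scaleE scale1r.
Qed.
Lemma tensA_scaleDr : right_distributive tensA_scale +%R.
Proof. exact: tensA_scaleD. Qed.
Lemma tensA_scaleDl t : {morph tensA_scale^~ t : a b / a + b}.
Proof.
move=> a b; elim/tens_ind: t => [|t u IH1 IH2|x y].
- by rewrite !tensA_scale0 addr0.
- by rewrite !tensA_scaleD IH1 IH2 addrACA.
- by rewrite !tensA_scaleE scalerDl tmkADl.
Qed.

HB.instance Definition _ := GRing.Zmodule_isLmodule.Build K T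
  tensA_scaleA tensA_scale1 tensA_scaleDr tensA_scaleDl.

Lemma tensA_lactDl a b t : tensA_lact (a + b) t = tensA_lact a t + tensA_lact b t.
Proof.
elim/tens_ind: t => [|t u IH1 IH2|x y]; first by rewrite !tensA_lact0 addr0.
  by rewrite !tensA_lactD IH1 IH2 addrACA.
by rewrite !tensA_lactE lactDl tmkADl.
Qed.
Lemma tensA_lactA a b t : tensA_lact a (tensA_lact b t) = tensA_lact (a * b) t.
Proof.
elim/tens_ind: t => [|t u IH1 IH2|x y]; first by rewrite !tensA_lact0.
  by rewrite !tensA_lactD IH1 IH2.
by rewrite !tensA_lactE lactA.
Qed.
Lemma tensA_lactK k (t : T) : tensA_lact k%:A t = k *: t.
Proof.
elim/tens_ind: t => [|t u IH1 IH2|x y]; first by rewrite tensA_lact0 scaler0.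
  by rewrite tensA_lactD IH1 IH2 scalerDr.
by rewrite tensA_lactE lactK; symmetry; apply: tensA_scaleE.
Qed.
Lemma tensA_ractDr t a b : tensA_ract t (a + b) = tensA_ract t a + tensA_ract t b.
Proof.
elim/tens_ind: t => [|t u IH1 IH2|x y]; first by rewrite !tensA_ract0 addr0.
  by rewrite !tensA_ractD IH1 IH2 addrACA.
by rewrite !tensA_ractE ractDr tmkADr.
Qed.
Lemma tensA_ractA t a b : tensA_ract (tensA_ract t a) b = tensA_ract t (a * b).
Proof.
elim/tens_ind: t => [|t u IH1 IH2|x y]; first by rewrite !tensA_ract0.
  by rewrite !tensA_ractD IH1 IH2.
by rewrite !tensA_ractE ractA.
Qed.
Lemma tensA_ractK k (t : T) : tensA_ract t k%:A = k *: t.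
Proof.
elim/tens_ind: t => [|t u IH1 IH2|x y]; first by rewrite tensA_ract0 scaler0.
  by rewrite tensA_ractD IH1 IH2 scalerDr.
rewrite tensA_ractE ractK -lactK -tmkA_bal ractK.
by symmetry; apply: tensA_scaleE.
Qed.
Lemma tensA_lractA a t b : tensA_ract (tensA_lact a t) b = tensA_lact a (tensA_ract t b).
Proof.
elim/tens_ind: t => [|t u IH1 IH2|x y].
- by rewrite tensA_lact0 tensA_ract0 tensA_lact0.
- by rewrite tensA_lactD !tensA_ractD tensA_lactD IH1 IH2.
- by rewrite tensA_lactE !tensA_ractE tensA_lactE.
Qed.

HB.instance Definition _ := isBimodule.Build K A T
  tensA_lactDl tensA_lactD tensA_lactA tensA_lactK
  tensA_ractD tensA_ractDr tensA_ractA tensA_ractK tensA_lractA.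

End TensA.

Notation "x \oxA y" := (tmkA x y) (at level 40, left associativity) : ring_scope.

Section DirectSum.
Variables (K : fieldType) (A : algType K) (T : nat -> bimodType A).

Record dsum := DSum {
  dval :> forall n, T n;
  dvalP : exists b, forall n, (b <= n)%N -> dval n = 0 }.

HB.instance Definition _ := gen_eqMixin dsum.
HB.instance Definition _ := gen_choiceMixin dsum.

Lemma dsum_ext (x y : dsum) : (forall n, x n = y n) -> x = y.
Proof.
case: x y => x px [y py] /= xy; have E : x = y by apply: functional_extensionality_dep.
by case: _ / E py => py; congr DSum; apply: Prop_irrelevance.
Qed.

Lemma dsum_map_fin (h : forall n, T n -> T n) (x : dsum) :
  (forall n, h n 0 = 0) -> exists b, forall n, (b <= n)%N -> h n (x n) = 0.
Proof. by move=> h0; have [b xb] := dvalP x; exists b => n /xb ->. Qed.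

Lemma dsum_zero_fin : exists b, forall n, (b <= n)%N -> (0 : T n) = 0.
Proof. by exists 0. Qed.
Definition dsum_zero := @DSum (fun n => 0) dsum_zero_fin.

Lemma dsum_add_fin (x y : dsum) :
  exists b, forall n, (b <= n)%N -> x n + y n = 0.
Proof.
have [b xb] := dvalP x; have [c yc] := dvalP y.
exists (maxn b c) => n; rewrite geq_max => /andP[bn cn].
by rewrite xb // yc // addr0.
Qed.
Definition dsum_add (x y : dsum) := DSum (dsum_add_fin x y).

Definition dsum_opp (x : dsum) :=
  DSum (dsum_map_fin x (h := fun n t => - t) (fun n => oppr0 (T n))).

Lemma dsum_addA : associative dsum_add.
Proof. by move=> x y z; apply: dsum_ext => n /=; rewrite addrA. Qed.
Lemma dsum_addC : commutative dsum_add.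
Proof. by move=> x y; apply: dsum_ext => n /=; rewrite addrC. Qed.
Lemma dsum_add0 : left_id dsum_zero dsum_add.
Proof. by move=> x; apply: dsum_ext => n /=; rewrite add0r. Qed.
Lemma dsum_addN : left_inverse dsum_zero dsum_opp dsum_add.
Proof. by move=> x; apply: dsum_ext => n /=; rewrite addNr. Qed.

HB.instance Definition _ :=
  GRing.isZmodule.Build dsum dsum_addA dsum_addC dsum_add0 dsum_addN.

Definition dsum_scale (k : K) (x : dsum) :=
  DSum (dsum_map_fin x (h := fun n t => k *: t) (fun n => scaler0 (T n) k)).

Lemma dsum_scaleA a b x : dsum_scale a (dsum_scale b x) = dsum_scale (a * b) x.
Proof. by apply: dsum_ext => n /=; rewrite scalerA. Qed.
Lemma dsum_scale1 : left_id 1 dsum_scale.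
Proof. by move=> x; apply: dsum_ext => n /=; rewrite scale1r. Qed.
Lemma dsum_scaleDr : right_distributive dsum_scale +%R.
Proof. by move=> k x y; apply: dsum_ext => n /=; rewrite scalerDr. Qed.
Lemma dsum_scaleDl x : {morph dsum_scale^~ x : a b / a + b}.
Proof. by move=> a b; apply: dsum_ext => n /=; rewrite scalerDl. Qed.

HB.instance Definition _ := GRing.Zmodule_isLmodule.Build K dsum
  dsum_scaleA dsum_scale1 dsum_scaleDr dsum_scaleDl.

Definition dsum_lact (a : A) (x : dsum) :=
  DSum (dsum_map_fin x (h := fun n t => a >* t) (fun n => lactr0 (T n) a)).
Definition dsum_ract (x : dsum) (a : A) :=
  DSum (dsum_map_fin x (h := fun n t => t *< a) (fun n => ractl0 (T n) a)).

Fact dsum_bimod : isBimodule K A dsum.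
Proof.
exists dsum_lact dsum_ract; intros; apply: dsum_ext => n /=.
- exact: lactDl.
- exact: lactDr.
- exact: lactA.
- exact: lactK.
- exact: ractDl.
- exact: ractDr.
- exact: ractA.
- exact: ractK.
- exact: lractA.
Defined.
HB.instance Definition _ := dsum_bimod.

Definition demb_val n (x : T n) k : T k :=
  if n =P k is ReflectT e then ecast j (T j : Type) e x else 0.

Lemma demb_fin n (x : T n) : exists b, forall k, (b <= k)%N -> demb_val x k = 0.
Proof.
exists n.+1 => k nk; rewrite /demb_val; case: eqP => // e.
by exfalso; move: nk; rewrite -e ltnn.
Qed.
Definition demb n (x : T n) : dsum := DSum (demb_fin x).

(* The linear extension of a family of linear maps given on the summands;
   the sum is finite because x has finitely many nonzero components. *)
Definition dsum_extend (F : forall n, T n -> dsum) (x : dsum) : dsum :=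
  \sum_(n \in [set n | x n != 0]%classic) F n (x n).

End DirectSum.

Record bicov_calculus (K : fieldType) (A : hopfAlgType K) := BicovCalculus {
  oneform :> bimodType A;
  dif : {linear A -> oneform};
  dif_leibniz : forall a b, dif (a * b) = dif a *< b + a >* dif b;
  dif_gen : forall w : oneform,
    exists s : seq (A * A), w = \sum_(p <- s) p.1 >* dif p.2;
  lcoact : {linear oneform -> tensK A oneform};
  lcoactE : forall a b,
    lcoact (a >* dif b) =
    tmap2 *%R lact (coprod a) (tmap id dif (coprod b));
  rcoact : {linear oneform -> tensK oneform A};
  rcoactE : forall a b,
    rcoact (a >* dif b) =
    tmap2 lact *%R (coprod a) (tmap dif id (coprod b)) }.

Definition left_invariant (K : fieldType) (A : hopfAlgType K)
    (G : bicov_calculus A) (w : G) : Prop := lcoact G w = 1 \ox w.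

(* psi * a for a in A *)
Definition conv (K : fieldType) (A : hopfAlgType K) (psi : A -> K) (a : A) : A :=
  slice psi (coprod a).

(* A basis of left-invariant one-forms with the associated structure
   functionals and matrix elements:  fun_f i j = f^i_j,  mat_M j i = M_j^i. *)
Record frame (K : fieldType) (A : hopfAlgType K) (G : bicov_calculus A)
    (N : nat) := Frame {
  omega : 'I_N -> G;
  omega_linv : forall i, left_invariant (omega i);
  omega_basis : forall w : G, left_invariant w ->
    exists! c : {ffun 'I_N -> K}, w = \sum_i c i *: omega i;
  omega_lfree : forall w : G,
    exists! a : {ffun 'I_N -> A}, w = \sum_i a i >* omega i;
  omega_rfree : forall w : G,
    exists! a : {ffun 'I_N -> A}, w = \sum_i omega i *< a i;
  fun_f : 'I_N -> 'I_N -> {scalar A};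
  fun_fE : forall i b, omega i *< b = \sum_j conv (fun_f i j) b >* omega j;
  mat_M : 'I_N -> 'I_N -> A;
  mat_ME : forall i, rcoact G (omega i) = \sum_j omega j \ox mat_M j i;
  chi : 'I_N -> {scalar A};
  chiE : forall a, dif G a = \sum_i conv (chi i) a >* omega i }.

Section Tensorfields.
Variables (K : fieldType) (A : hopfAlgType K) (G : bicov_calculus A).

(* The degree 1 component is A (x)_A G, canonically G. *)
Fixpoint tpow (n : nat) : bimodType A :=
  if n is m.+1 then tensA (tpow m) G else regular_bimod A.

Definition tensorfield : bimodType A := dsum tpow.

Definition emb n (x : tpow n) : tensorfield := demb x.
Definition emb_fun (a : A) : tensorfield := emb (a : tpow 0).
Definition emb_form (w : G) : tensorfield := emb ((1 : regular_bimod A) \oxA w : tpow 1).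

(* x (x) w |-> x_1 (x) w_1 (x) x_2 w_2 *)
Fixpoint rcoact_pow (n : nat) : tpow n -> tensK (tpow n) A :=
  match n return tpow n -> tensK (tpow n) A with
  | 0 => @coprod K A
  | m.+1 => tliftA (fun (x : tpow m) (w : G) =>
      tmap2 (fun x1 w1 => x1 \oxA w1 : tpow m.+1) *%R
        (rcoact_pow x) (rcoact G w))
  end.

(* psi * theta *)
Definition conv_tens (psi : A -> K) : tensorfield -> tensorfield :=
  dsum_extend (fun n x => emb (slice psi (rcoact_pow x))).

Fixpoint tcat m (x : tpow m) (n : nat) : tpow n -> tpow (n + m) :=
  match n return tpow n -> tpow (n + m) with
  | 0 => fun a => x *< (a : A)
  | p.+1 => tliftA (fun (y : tpow p) (w : G) =>
      tcat x y \oxA w : tpow (p + m).+1)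
  end.

Definition tens_mul (x y : tensorfield) : tensorfield :=
  dsum_extend (fun m (s : tpow m) =>
    dsum_extend (fun n (t : tpow n) => emb (tcat s t)) y) x.

End Tensorfields.

Section Exterior.
Variables (K : fieldType) (A : hopfAlgType K) (G : bicov_calculus A).
Variables (N : nat) (F : frame G N).

Definition midx (n : nat) := {ffun 'I_n -> 'I_N}.
Definition midx_init n (i : midx n.+1) : midx n :=
  [ffun k => i (widen_ord (leqnSn n) k)].
Definition midx_last n (i : midx n.+1) : 'I_N := i ord_max.

Definition imx n (E : midx n -> midx n -> K) : 'M[K]_#|{: midx n}| :=
  \matrix_(r, s) E (enum_val r) (enum_val s).
Definition ient n (X : 'M[K]_#|{: midx n}|) (i j : midx n) : K :=
  X (enum_rank i) (enum_rank j).

(* braid i j k l = Lambda^{ij}_{kl} *)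
Definition braid (i j k l : 'I_N) : K := fun_f F i l (mat_M F k j).

(* Lambda on the factors numbered m and m.+1 (counting from 0) of n.+1 *)
Definition braid_mx n (m : nat) : 'M[K]_#|{: midx n.+1}| :=
  let p : 'I_n.+1 := inord m in
  let q : 'I_n.+1 := inord m.+1 in
  imx (fun i j => braid (i p) (i q) (j p) (j q) *
    [forall k, (k != p) && (k != q) ==> (i k == j k)]%:R).

(* I_{1...n+1}: with n.+1 factors counted from 0, the k-th summand is
   (-1)^k Lambda_{n-k,n-k+1} ... Lambda_{n-1,n}. *)
Definition shuffle_mx n : 'M[K]_#|{: midx n.+1}| :=
  1%:M + \sum_(1 <= k < n.+1)
    (-1) ^+ k *: \big[mulmx/1%:M]_(n - k <= m < n) braid_mx n m.

Fixpoint alt_mx (n : nat) : 'M[K]_#|{: midx n}| :=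
  match n return 'M[K]_#|{: midx n}| with
  | 0 => 1%:M
  | m.+1 => shuffle_mx m *m
      imx (fun i j => ient (alt_mx m) (midx_init i) (midx_init j) *
                      (midx_last i == midx_last j)%:R)
  end.

Fixpoint tbasis (n : nat) : midx n -> tpow G n :=
  match n return midx n -> tpow G n with
  | 0 => fun _ => (1 : A)
  | m.+1 => fun i => tbasis (midx_init i) \oxA omega F (midx_last i)
  end.

(* omega^{i_1} /\ ... /\ omega^{i_n} *)
Definition wbasis n (i : midx n) : tpow G n :=
  \sum_j ient (alt_mx n) i j *: tbasis j.

Definition exterior n (x : tpow G n) : Prop :=
  exists a : {ffun midx n -> A}, x = \sum_i a i >* wbasis i.

(* The left coefficients of x on the tensor basis; they exist and are unique
   because G is free on omega. *)
Definition tcoef n (x : tpow G n) : {ffun midx n -> A} :=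
  xget 0 [set a : {ffun midx n -> A} | x = \sum_i a i >* tbasis i]%classic.

(* The left A-linear map sending omega^{i_1} (x) ... (x) omega^{i_n} to
   omega^{i_1} /\ ... /\ omega^{i_n}; exterior forms are its values. *)
Definition altern : tensorfield G -> tensorfield G :=
  dsum_extend (fun n x => emb (\sum_i tcoef x i >* wbasis i)).

(* The product of exterior forms is induced by the tensor product: it sends
   (altern s, altern t) to altern (s (x) t), which does not depend on the
   choice of s and t. *)
Definition unaltern (x : tensorfield G) : tensorfield G :=
  xget 0 [set s | altern s = x]%classic.
Definition wedge (x y : tensorfield G) : tensorfield G :=
  altern (tens_mul (unaltern x) (unaltern y)).

Definition tvec (i : 'I_N) : A -> A := conv (chi F i).

(* t_i <> b^i *)
Definition vectorfield (b : {ffun 'I_N -> A}) : A -> A :=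
  fun a => \sum_i tvec i a * b i.

(* The coefficients of V; they are unique because G is spanned by the a db. *)
Definition vcoef (V : A -> A) : {ffun 'I_N -> A} :=
  xget 0 [set b | V = vectorfield b]%classic.

Definition contract_pow (V : A -> A) n (x : tpow G n.+1) : tpow G n :=
  (-1) ^+ n *: \sum_i (tcoef x i >* tbasis (midx_init i)) *< vcoef V (midx_last i).

Definition contract (V : A -> A) : tensorfield G -> tensorfield G :=
  dsum_extend (fun n =>
    match n return tpow G n -> tensorfield G with
    | 0 => fun _ => 0
    | m.+1 => fun x => emb (contract_pow V x)
    end).

End Exterior.

(* Main.v *)
From HB Require Import structures.
Require Import Defs.
From mathcomp Require Import all_boot all_order all_algebra.
From mathcomp Require Import boolp classical_sets functions cardinality fsbigop.
From mathcomp Require Import reals complex.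

Set Implicit Arguments.
Unset Strict Implicit.
Unset Printing Implicit Defensive.

Import GRing.Theory.
Local Open Scope ring_scope.

(** Forms are contracted in their last tensor factor, and every coefficient in
    sight is unique: [Gamma^(x)n] is free on the tensor basis ([tbasis_free]),
    and a vectorfield determines its coefficients because [Gamma] is spanned by
    the [a db] ([vectorfield_inj]).  Hence (a'), (b'), (c'), (e') and (g') are
    read off the coefficients, and (f') is the commutation rule
    [omega^i a = (f^i_j * a) omega^j] in the last factor ([contr_ract]).

    The content is (d').  Contraction is pulled back along the
    antisymmetrization [altern].  On all tensors define [ins_j], with
    repeated indices summed, by
      [ins_j a = 0],
      [ins_j (x (x) w) = (-1)^deg(x) x c_j(w) + ins_i(x) (x) (f^i_j * w)],
    where [c_j(w)] is the coefficient of [omega^j] in the one-form [w]; this is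
    what (d') predicts when the second form is a one-form.  By induction on the
    second factor [ins_j] obeys (d') for the tensor product
    ([ins_tens_mul]), because [f^i_j(ab) = f^i_k(a) f^k_j(b)].  The recursion
    [I_(n+1) = 1 - (I_n (x) 1) Lambda_(n,n+1)] of the matrices defining [altern]
    ([shuffle_mxS]) has the same shape as that of [ins_j], so that
      [altern y = (-1)^n altern (ins_j y) (x) omega^j] in degree [n+1]
    ([altern_rec]); reading off the last factor, contracting [altern y] gives
    [altern (ins_j y)] ([contr_altern]).

    It remains to see that the wedge product of [altern s] and [altern t] is
    [altern (s (x) t)] for all [s] and [t] ([wedge_altern]), that is, that the
    kernel of [altern] is a two-sided ideal.  By [altern_rec] and the rule for
    [ins_j] of a product this is an induction on the degree
    ([altern_ker_homog]), once [altern] is known to commute with the operators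
    [f^k_l *] ([altern_conv_tens]).  The latter rests on the fact that [Lambda]
    intertwines the products [f^i_k * f^j_l] ([braid_cform2]), which follows
    from the identity [(f^j_i * a) M_k^i = M_i^j (a * f^i_k)] ([conv_mat_M]):
    the right coaction of [Gamma] is compatible with both module structures.
    Neither the braid equation nor a sum over permutations is needed. *)

(** * Additive maps *)

Section AdditiveMaps.
Variables (U V : zmodType) (f : U -> V).
Hypothesis fD : {morph f : x y / x + y}.

Lemma morphD0 : f 0 = 0.
Proof. by apply: (addrI (f 0)); rewrite -fD !addr0. Qed.

Lemma morphDN x : f (- x) = - f x.
Proof. by apply/eqP; rewrite -addr_eq0 -fD addNr morphD0. Qed.

Lemma morphDB x y : f (x - y) = f x - f y.
Proof. by rewrite fD morphDN. Qed.

Lemma morphD_sum I (r : seq I) (P : pred I) (E : I -> U) :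
  f (\sum_(i <- r | P i) E i) = \sum_(i <- r | P i) f (E i).
Proof. exact: (big_morph f fD morphD0). Qed.

End AdditiveMaps.

(** * Tensor products over the base field *)

Section TensKTheory.
Variable K : fieldType.

(** Linear, bilinear and scalar-valued linear maps, as predicates on bare
    functions: the maps met below are mostly composites that carry no bundled
    structure. *)
Definition klinear (M N : lmodType K) (f : M -> N) : Prop :=
  {morph f : x y / x + y} /\ forall k, {morph f : x / k *: x}.

Definition kbilinear (M N P : lmodType K) (f : M -> N -> P) : Prop :=
  (forall y, klinear (f^~ y)) /\ (forall x, klinear (f x)).

Definition kfunctional (M : lmodType K) (f : M -> K) : Prop :=
  {morph f : x y / x + y} /\ forall k x, f (k *: x) = k * f x.

Lemma linear_klinear (M N : lmodType K) (f : {linear M -> N}) : klinear f.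
Proof. by split=> [x y|k x]; rewrite (linearD, linearZ). Qed.

Lemma scalar_kfunctional (M : lmodType K) (f : {scalar M}) : kfunctional f.
Proof. by split=> [x y|k x]; rewrite (linearD, linearZ). Qed.

(** The map [psi (x) id], the left-handed counterpart of [slice]. *)
Definition lslice (M N : lmodType K) (psi : M -> K) : tensK M N -> N :=
  tlift (fun x y => psi x *: y).

Section Pure.
Variables M N : lmodType K.

Let kbal (W : zmodType) (f : M -> N -> W) :=
  balanced (fun x (k : K) => k *: x) (fun (k : K) y => k *: y) f.

Lemma tmkDl (x x' : M) (y : N) : (x + x') \ox y = x \ox y + x' \ox y.
Proof. by have [D _ _] := balanced_pure (fun (x : M) (k : K) => k *: x)
  (fun (k : K) (y : N) => k *: y); apply: D. Qed.

Lemma tmkDr (x : M) (y y' : N) : x \ox (y + y') = x \ox y + x \ox y'.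
Proof. by have [_ D _] := balanced_pure (fun (x : M) (k : K) => k *: x)
  (fun (k : K) (y : N) => k *: y); apply: D. Qed.

Lemma tmkZl k (x : M) (y : N) : (k *: x) \ox y = k *: (x \ox y).
Proof. by symmetry; apply: tensK_scaleE. Qed.

Lemma tmkZr k (x : M) (y : N) : x \ox (k *: y) = k *: (x \ox y).
Proof. by rewrite -tmkZl; have [_ _ B] := balanced_pure
  (fun (x : M) (k : K) => k *: x) (fun (k : K) (y : N) => k *: y);
  symmetry; apply: B. Qed.

Lemma tensK_ind (P : tensK M N -> Prop) :
  P 0 -> (forall t u, P t -> P u -> P (t + u)) ->
  (forall x y, P (x \ox y)) -> forall t, P t.
Proof. exact: tens_ind. Qed.

Section Lift.
Variables (W : zmodType) (f : M -> N -> W).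
Hypothesis bf : kbal f.
Lemma tliftE x y : tlift f (x \ox y) = f x y.
Proof. exact: tens_lift_pure. Qed.
Lemma tliftD : {morph tlift f : t u / t + u}.
Proof. by move=> t u; apply: tens_liftD. Qed.
End Lift.

Lemma kbilinear_balanced (W : lmodType K) (f : M -> N -> W) :
  kbilinear f -> kbal f.
Proof.
by case=> fl fr; split=> [x x' y|x y y'|x k y];
  rewrite ?(fl y).1 ?(fl y).2 ?(fr x).1 ?(fr x).2.
Qed.

Lemma tlift_linear (W : lmodType K) (f : M -> N -> W) :
  kbilinear f -> klinear (tlift f).
Proof.
move=> bf; have bal := kbilinear_balanced bf; split; first exact: tliftD.
move=> k t; elim/tensK_ind: t => [|t u IHt IHu|x y].
- by rewrite scaler0 (morphD0 (tliftD bal)) scaler0.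
- by rewrite scalerDr !(tliftD bal) IHt IHu scalerDr.
- by rewrite -tmkZl !tliftE // (bf.1 y).2.
Qed.

Lemma slice_bilinear (psi : N -> K) :
  kfunctional psi -> kbilinear (fun (x : M) y => psi y *: x).
Proof.
case=> pD pZ; split=> [y|x]; split=> [u v|k u].
- by rewrite scalerDr.
- by rewrite !scalerA mulrC.
- by rewrite pD scalerDl.
- by rewrite pZ scalerA.
Qed.

Lemma sliceE (psi : N -> K) (x : M) y :
  kfunctional psi -> slice psi (x \ox y) = psi y *: x.
Proof. by move=> pl; apply: tliftE; apply/kbilinear_balanced/slice_bilinear. Qed.

Lemma slice_linear (psi : N -> K) :
  kfunctional psi -> klinear (slice psi : tensK M N -> M).
Proof. by move=> pl; apply: tlift_linear; apply: slice_bilinear. Qed.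

Lemma lslice_bilinear (psi : M -> K) :
  kfunctional psi -> kbilinear (fun x (y : N) => psi x *: y).
Proof.
case=> pD pZ; split=> [y|x]; split=> [u v|k u].
- by rewrite pD scalerDl.
- by rewrite pZ scalerA.
- by rewrite scalerDr.
- by rewrite !scalerA mulrC.
Qed.

Lemma lsliceE (psi : M -> K) x (y : N) :
  kfunctional psi -> lslice psi (x \ox y) = psi x *: y.
Proof. by move=> pl; apply/tliftE/kbilinear_balanced/lslice_bilinear. Qed.

Lemma lslice_linear (psi : M -> K) :
  kfunctional psi -> klinear (lslice psi : tensK M N -> N).
Proof. by move=> pl; apply/tlift_linear/lslice_bilinear. Qed.

End Pure.

Section Map.
Variables (M N M' N' : lmodType K) (f : M -> M') (g : N -> N').
Hypotheses (fl : klinear f) (gl : klinear g).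

Let bil : kbilinear (fun x y => f x \ox g y).
Proof.
split=> [y|x]; split=> [u v|k u]; rewrite ?fl.1 ?fl.2 ?gl.1 ?gl.2;
  by rewrite (tmkDl, tmkDr, tmkZl, tmkZr).
Qed.

Lemma tmapE x y : tmap f g (x \ox y) = f x \ox g y.
Proof. exact/tliftE/kbilinear_balanced. Qed.
Lemma tmap_linear : klinear (tmap f g).
Proof. exact: tlift_linear. Qed.
End Map.

Section Map2.
Variables (M N M' N' P Q : lmodType K).
Variables (f : M -> M' -> P) (g : N -> N' -> Q).
Hypotheses (fb : kbilinear f) (gb : kbilinear g).

Let inner x y : kbilinear (fun x' y' => f x x' \ox g y y').
Proof.
split=> [y'|x']; split=> [u v|k u];
  rewrite ?(fb.2 x).1 ?(fb.2 x).2 ?(gb.2 y).1 ?(gb.2 y).2;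
  by rewrite (tmkDl, tmkDr, tmkZl, tmkZr).
Qed.

Let outer u : kbilinear (fun x y => tlift (fun x' y' => f x x' \ox g y y') u).
Proof.
have tE x y x' y' :
    tlift (fun x' y' => f x x' \ox g y y') (x' \ox y') = f x x' \ox g y y'.
  exact/tliftE/kbilinear_balanced/inner.
have tl x y := tlift_linear (inner x y).
split=> [y|x]; split=> [v w|k v]; elim/tensK_ind: u => [|t u IHt IHu|x' y'].
- by rewrite !(morphD0 (tl _ _).1) addr0.
- by rewrite !(tl _ _).1 IHt IHu addrACA.
- by rewrite !tE (fb.1 x').1 tmkDl.
- by rewrite !(morphD0 (tl _ _).1) scaler0.
- by rewrite !(tl _ _).1 IHt IHu scalerDr.
- by rewrite !tE (fb.1 x').2 tmkZl.
- by rewrite !(morphD0 (tl _ _).1) addr0.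
- by rewrite !(tl _ _).1 IHt IHu addrACA.
- by rewrite !tE (gb.1 y').1 tmkDr.
- by rewrite !(morphD0 (tl _ _).1) scaler0.
- by rewrite !(tl _ _).1 IHt IHu scalerDr.
- by rewrite !tE (gb.1 y').2 tmkZr.
Qed.

Lemma tmap2E x y x' y' :
  tmap2 f g (x \ox y) (x' \ox y') = f x x' \ox g y y'.
Proof.
rewrite /tmap2 tliftE; last exact: (kbilinear_balanced (outer _)).
exact: (tliftE (kbilinear_balanced (inner _ _))).
Qed.

Lemma tmap2_bilinear : kbilinear (tmap2 f g).
Proof.
split=> [u|t]; first exact: tlift_linear.
have tl x y := tlift_linear (inner x y).
have lD u : {morph (fun t => tmap2 f g t u) : t t' / t + t'}.
  exact: (tlift_linear (outer u)).1.
split=> [u v|k u]; elim/tensK_ind: t => [|t t' IHt IHt'|x y].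
- by rewrite !(morphD0 (lD _)) addr0.
- by rewrite !lD IHt IHt' addrACA.
- rewrite /tmap2 !(tliftE (kbilinear_balanced (outer _))).
  exact: (tl x y).1.
- by rewrite !(morphD0 (lD _)) scaler0.
- by rewrite !lD IHt IHt' scalerDr.
- rewrite /tmap2 !(tliftE (kbilinear_balanced (outer _))).
  exact: (tl x y).2.
Qed.

End Map2.

Lemma tensK_additive_ext (M N : lmodType K) (W : zmodType) (f g : tensK M N -> W) :
  {morph f : x y / x + y} -> {morph g : x y / x + y} ->
  (forall x y, f (x \ox y) = g (x \ox y)) -> f =1 g.
Proof.
move=> fD gD fg t; elim/tensK_ind: t => [|t u IHt IHu|x y] //.
  by rewrite (morphD0 fD) (morphD0 gD).
by rewrite fD gD IHt IHu.
Qed.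

End TensKTheory.

(** * Products of tensors with values in the algebra *)

Section Tmap2Assoc.
Variables (K : fieldType) (A : algType K).

Lemma mul_bilinear : kbilinear ( *%R : A -> A -> A).
Proof.
split=> [y|x]; split=> [u v|k u] /=.
- exact: mulrDl.
- by rewrite scalerAl.
- exact: mulrDr.
- by rewrite scalerAr.
Qed.

Lemma lact_bilinear (M : bimodType A) : kbilinear (lact : A -> M -> M).
Proof. by split=> [y|x]; split=> [u v|k u]; rewrite (lactDl, lactDr, lactZl, lactZr). Qed.

Lemma ract_bilinear (M : bimodType A) : kbilinear (ract : M -> A -> M).
Proof. by split=> [y|x]; split=> [u v|k u]; rewrite (ractDl, ractDr, ractZl, ractZr). Qed.

Lemma tmkA_bilinear (M N : bimodType A) :
  kbilinear (fun (x : M) (y : N) => x \oxA y : tensA M N).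
Proof.
have Zl k (x : M) (y : N) : (k *: x) \oxA y = k *: (x \oxA y) :> tensA M N.
  by symmetry; apply: tensA_scaleE.
split=> [y|x]; split=> [u v|k u]; rewrite ?(tmkADl, tmkADr) //.
by rewrite -Zl -lactK -tmkA_bal ractK.
Qed.

Variables (M1 M2 M3 M12 M23 M : lmodType K).
Variables (f1 : M1 -> M2 -> M12) (f2 : M12 -> M3 -> M).
Variables (f3 : M2 -> M3 -> M23) (f4 : M1 -> M23 -> M).
Hypotheses (b1 : kbilinear f1) (b2 : kbilinear f2).
Hypotheses (b3 : kbilinear f3) (b4 : kbilinear f4).
Hypothesis fA : forall x y z, f2 (f1 x y) z = f4 x (f3 y z).

(** Associativity of the componentwise product of tensors whose second
    components lie in [A]; it covers all module axioms transported through
    coproducts and coactions. *)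
Lemma tmap2A (t : tensK M1 A) (u : tensK M2 A) (v : tensK M3 A) :
  tmap2 f2 *%R (tmap2 f1 *%R t u) v = tmap2 f4 *%R t (tmap2 f3 *%R u v).
Proof.
have [l1 r1] := tmap2_bilinear b1 mul_bilinear.
have [l2 r2] := tmap2_bilinear b2 mul_bilinear.
have [l3 r3] := tmap2_bilinear b3 mul_bilinear.
have [l4 r4] := tmap2_bilinear b4 mul_bilinear.
have z1 u' := morphD0 (l1 u').1; have z1' u' := morphD0 (r1 u').1.
have z2 u' := morphD0 (l2 u').1; have z2' u' := morphD0 (r2 u').1.
have z3 u' := morphD0 (l3 u').1; have z3' u' := morphD0 (r3 u').1.
have z4 u' := morphD0 (l4 u').1; have z4' u' := morphD0 (r4 u').1.
elim/tensK_ind: t => [|t t' IHt IHt'|x1 y1]; first by rewrite z1 z2 z4.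
  by rewrite (l1 _).1 (l2 _).1 IHt IHt' (l4 _).1.
elim/tensK_ind: u => [|u u' IHt IHt'|x2 y2]; first by rewrite z1' z2 z3 z4'.
  by rewrite (r1 _).1 (l2 _).1 IHt IHt' (l3 _).1 (r4 _).1.
elim/tensK_ind: v => [|v v' IHt IHt'|x3 y3]; first by rewrite z2' z3' z4'.
  by rewrite (r2 _).1 IHt IHt' (r3 _).1 (r4 _).1.
by rewrite !tmap2E ?mulrA ?fA //; exact: mul_bilinear.
Qed.

End Tmap2Assoc.

(** * Convolution on a Hopf algebra *)

Section HopfConv.
Variables (K : fieldType) (A : hopfAlgType K).
Implicit Types (a b : A) (psi phi : {scalar A}).

Lemma coprod_klinear : klinear (coprod : A -> tensK A A).
Proof.
have l := @coprod_linear K A.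
have D : {morph (coprod : A -> tensK A A) : x y / x + y}.
  by move=> x y; have := l 1 x y; rewrite !scale1r.
split=> // k x; have := l k x 0.
by rewrite addr0 (morphD0 D) addr0.
Qed.

Lemma counit_kfunctional : kfunctional (counit : A -> K).
Proof.
have l := @counit_scalar K A.
have D : {morph (counit : A -> K) : x y / x + y}.
  by move=> x y; have := l 1 x y; rewrite !scale1r mul1r.
split=> // k x; have := l k x 0.
by rewrite addr0 (morphD0 D) addr0.
Qed.

Lemma conv_linear (psi : A -> K) : kfunctional psi -> klinear (conv psi).
Proof.
move=> pl; have sl := slice_linear A pl; have cl := coprod_klinear.
by split=> [x y|k x]; rewrite /conv (cl.1, cl.2) (sl.1, sl.2).
Qed.

(** Both sides are [psi(a_1) phi(a_2)]. *)
Lemma lslice_coprod (psi phi : A -> K) a : kfunctional psi -> kfunctional phi ->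
  phi (lslice psi (coprod a)) = psi (conv phi a).
Proof.
move=> pl fl; have sl := slice_linear A fl; have ll := lslice_linear A pl.
apply: (@tensK_additive_ext K A A K (fun t => phi (lslice psi t))
  (fun t => psi (slice phi t))) => [t u|t u|x y].
- by rewrite ll.1 fl.1.
- by rewrite sl.1 pl.1.
- by rewrite sliceE // lsliceE // pl.2 fl.2 mulrC.
Qed.

Lemma counit_conv (psi : A -> K) a : kfunctional psi -> counit (conv psi a) = psi a.
Proof.
move=> pl; rewrite -(lslice_coprod _ (counit_kfunctional) pl).
by rewrite [lslice _ _]counitl.
Qed.

Lemma kfunctional_conv (psi phi : A -> K) : kfunctional psi -> kfunctional phi ->
  kfunctional (fun a => psi (conv phi a)).
Proof.
move=> pl fl; have cl := conv_linear fl.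
by split=> [x y|k x]; rewrite (cl.1, cl.2) (pl.1, pl.2).
Qed.

(** Coassociativity: [psi * (phi * a)] is the convolution of [a] with the
    product functional [b |-> psi(b_1) phi(b_2)]. *)
Lemma conv_conv (psi phi : A -> K) a : kfunctional psi -> kfunctional phi ->
  conv psi (conv phi a) = conv (fun b => psi (conv phi b)) a.
Proof.
move=> pl fl; have cl := coprod_klinear; have il : klinear (@id A) by [].
have sp := slice_linear A pl; have sf := slice_linear A fl.
have tal := tmap_linear cl il; have tar := tmap_linear il cl.
have kl : kfunctional (fun b => psi (conv phi b)) by exact: kfunctional_conv.
have kl' : kfunctional (fun t : tensK A A => psi (slice phi t)).
  by split=> [x y|k x]; rewrite (sf.1, sf.2) (pl.1, pl.2).
rewrite /conv.
have -> : coprod (slice phi (coprod a)) = slice phi (tmap coprod id (coprod a)).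
  have sf' := slice_linear (tensK A A) fl.
  apply: (@tensK_additive_ext K A A _ (fun t => coprod (slice phi t))
    (fun t => slice phi (tmap coprod id t))) => [t u|t u|x y].
  - by rewrite sf.1 cl.1.
  - by rewrite tal.1 sf'.1.
  - by rewrite tmapE // !sliceE // cl.2.
have sa' := slice_linear A kl'.
have in_bil (z : A) : kbilinear (fun x y : A => x \ox (y \ox z)).
  split=> [y|x]; split=> [u v|k u]; rewrite ?tmkDl ?tmkDr ?tmkZl ?tmkZr //.
have as_bil : kbilinear (fun (t : tensK A A) (z : A) => tlift (fun x y : A => x \ox (y \ox z)) t).
  have tl z := tlift_linear (in_bil z).
  split=> [z|w]; first exact: tlift_linear.
  split=> [u v|k u]; elim/tensK_ind: w => [|t t' IHt IHt'|x y].
  - by rewrite !(morphD0 (tl _).1) addr0.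
  - by rewrite !(tl _).1 IHt IHt' addrACA.
  - by rewrite !(tliftE (kbilinear_balanced (in_bil _))) !tmkDr.
  - by rewrite !(morphD0 (tl _).1) scaler0.
  - by rewrite !(tl _).1 IHt IHt' scalerDr.
  - by rewrite !(tliftE (kbilinear_balanced (in_bil _))) !tmkZr.
have asl := tlift_linear as_bil.
have -> : slice psi (slice phi (tmap coprod id (coprod a))) =
    slice (fun t : tensK A A => psi (slice phi t))
      (tassoc (tmap coprod id (coprod a))).
  have sf' := slice_linear (tensK A A) fl.
  apply: (@tensK_additive_ext K (tensK A A) A _ (fun v => slice psi (slice phi v))
    (fun v => slice (fun t : tensK A A => psi (slice phi t)) (tassoc v)))
     => [t u|t u|t z].
  - by rewrite sf'.1 sp.1.
  - by rewrite /tassoc asl.1 sa'.1.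
  - rewrite /tassoc (tliftE (kbilinear_balanced as_bil)).
    have tl := tlift_linear (in_bil z).
    apply: (@tensK_additive_ext K A A _ (fun v => slice psi (slice phi (v \ox z)))
     (fun v => slice (fun t : tensK A A => psi (slice phi t))
        (tlift (fun x y => x \ox (y \ox z)) v))) => [u v|u v|x y].
    + by rewrite tmkDl sf'.1 sp.1.
    + by rewrite tl.1 sa'.1.
    + rewrite (tliftE (kbilinear_balanced (in_bil z))).
      by rewrite !sliceE // sp.2 !sliceE // pl.2 scalerA.
rewrite coprodA.
apply: (@tensK_additive_ext K A A _
    (fun v => slice (fun t : tensK A A => psi (slice phi t)) (tmap id coprod v))
    (fun v => slice (fun b => psi (slice phi (coprod b))) v)) => [u v|u v|x y].
- by rewrite tar.1 sa'.1.
- by rewrite (slice_linear A kl).1.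
- by rewrite tmapE // !sliceE.
Qed.

End HopfConv.

(** * The calculus and its right coaction *)

Section BimoduleExtra.
Variables (K : fieldType) (A : algType K) (M : bimodType A).

Lemma lact1 (x : M) : 1 >* x = x.
Proof. by rewrite -[1]scale1r lactK scale1r. Qed.
Lemma ract1 (x : M) : x *< 1 = x.
Proof. by rewrite -[1]scale1r ractK scale1r. Qed.
Lemma lactl0 (x : M) : 0 >* x = 0.
Proof. by rewrite -(scale0r 1) lactK scale0r. Qed.
Lemma ractr0 (x : M) : x *< 0 = 0.
Proof. by rewrite -(scale0r 1) ractK scale0r. Qed.
Lemma lact_suml I (r : seq I) (P : pred I) (E : I -> A) (x : M) :
  (\sum_(i <- r | P i) E i) >* x = \sum_(i <- r | P i) E i >* x.
Proof. exact: (morphD_sum (fun a b => lactDl a b x)). Qed.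
Lemma lact_sumr I (r : seq I) (P : pred I) (E : I -> M) (a : A) :
  a >* (\sum_(i <- r | P i) E i) = \sum_(i <- r | P i) a >* E i.
Proof. exact: (morphD_sum (lactDr a)). Qed.
Lemma ract_suml I (r : seq I) (P : pred I) (E : I -> M) (a : A) :
  (\sum_(i <- r | P i) E i) *< a = \sum_(i <- r | P i) E i *< a.
Proof. exact: (morphD_sum (fun x y => ractDl x y a)). Qed.
Lemma ract_sumr I (r : seq I) (P : pred I) (E : I -> A) (x : M) :
  x *< (\sum_(i <- r | P i) E i) = \sum_(i <- r | P i) x *< E i.
Proof. exact: (morphD_sum (ractDr x)). Qed.
End BimoduleExtra.

Section SliceMatrix.
Variables (K : fieldType) (A : algType K) (I : finType).
Variable f : I -> I -> A -> K.
Hypothesis fl : forall i j, kfunctional (f i j).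
Hypothesis fM : forall i j a b, f i j (a * b) = \sum_k f i k a * f k j b.

(** A family of functionals that is multiplicative as a matrix slices a product
    of tensors as a matrix product. *)
Lemma slice_tmap2 (M M' P : lmodType K) (B : M -> M' -> P)
    (t : tensK M A) (u : tensK M' A) i j : kbilinear B ->
  slice (f i j) (tmap2 B *%R t u) = \sum_k B (slice (f i k) t) (slice (f k j) u).
Proof.
move=> bB; have [l r] := tmap2_bilinear bB (mul_bilinear A).
have sP := slice_linear P (fl i j).
have sM i' j' := slice_linear M (fl i' j').
have sM' i' j' := slice_linear M' (fl i' j').
apply: (@tensK_additive_ext K M A _ (fun t => slice (f i j) (tmap2 B *%R t u))
   (fun t => \sum_k B (slice (f i k) t) (slice (f k j) u))) => [x y|x y|x a].
- by rewrite (l u).1 sP.1.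
- by rewrite -big_split; apply: eq_bigr => k _; rewrite (sM i k).1 (bB.1 _).1.
apply: (@tensK_additive_ext K M' A _ (fun u => slice (f i j) (tmap2 B *%R (x \ox a) u))
   (fun u => \sum_k B (slice (f i k) (x \ox a)) (slice (f k j) u))) => [y z|y z|y b].
- by rewrite (r _).1 sP.1.
- by rewrite -big_split; apply: eq_bigr => k _; rewrite (sM' k j).1 (bB.2 _).1.
rewrite tmap2E ?sliceE //; last exact: mul_bilinear.
rewrite fM scaler_suml; apply: eq_bigr => k _.
by rewrite !sliceE // (bB.1 _).2 (bB.2 _).2 scalerA.
Qed.

End SliceMatrix.

Section Calculus.
Variables (K : fieldType) (A : hopfAlgType K) (G : bicov_calculus A).

Lemma dif_ind (P : G -> Prop) :
  (forall x y, P x -> P y -> P (x + y)) -> P 0 ->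
  (forall a b, P (a >* dif G b)) -> forall w, P w.
Proof. by move=> PD P0 Pd w; have [s ->] := dif_gen w; apply: big_ind. Qed.

Let rl := linear_klinear (rcoact G).
Let dl := linear_klinear (dif G).

Lemma rcoact_lact c (w : G) :
  rcoact G (c >* w) = tmap2 lact *%R (coprod c) (rcoact G w).
Proof.
have [l r] := tmap2_bilinear (lact_bilinear G) (mul_bilinear A).
elim/dif_ind: w => [x y IHx IHy||a b].
- by rewrite lactDr !rl.1 IHx IHy (r _).1.
- by rewrite lactr0 !(morphD0 rl.1) (morphD0 (r _).1).
rewrite lactA !rcoactE coprodM.
apply: tmap2A => [||||x y z]; last (by rewrite lactA);
  by [exact: mul_bilinear | exact: lact_bilinear].
Qed.

(** By the Leibniz rule [(a db) c = a d(bc) - (ab) dc]. *)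
Lemma rcoact_ract c (w : G) :
  rcoact G (w *< c) = tmap2 ract *%R (rcoact G w) (coprod c).
Proof.
have [l r] := tmap2_bilinear (ract_bilinear G) (mul_bilinear A).
have [l' r'] := tmap2_bilinear (lact_bilinear G) (mul_bilinear A).
have [l2 r2] := tmap2_bilinear (mul_bilinear A) (mul_bilinear A).
have il : klinear (@id A) by [].
have ml := tmap_linear dl il.
elim/dif_ind: w => [x y IHx IHy||a b].
- by rewrite ractDl !rl.1 IHx IHy (l _).1.
- by rewrite ractl0 !(morphD0 rl.1) (morphD0 (l _).1).
have -> : a >* dif G b *< c = a >* dif G (b * c) - (a * b) >* dif G c.
  by rewrite dif_leibniz lractA lactDr -lactA addrK.
rewrite (morphDB rl.1) !rcoactE !coprodM.
have -> : tmap (dif G) id (tmap2 *%R *%R (coprod b) (coprod c)) =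
    tmap2 ract *%R (tmap (dif G) id (coprod b)) (coprod c) +
    tmap2 lact *%R (coprod b) (tmap (dif G) id (coprod c)).
  move: (coprod b) (coprod c) => t u.
  apply: (@tensK_additive_ext K A A _
   (fun t => tmap (dif G) id (tmap2 *%R *%R t u))
   (fun t => tmap2 ract *%R (tmap (dif G) id t) u +
    tmap2 lact *%R t (tmap (dif G) id u))) => [x y|x y|x x'].
  - by rewrite (l2 _).1 ml.1.
  - by rewrite ml.1 (l _).1 (l' _).1 addrACA.
  apply: (@tensK_additive_ext K A A _
   (fun u => tmap (dif G) id (tmap2 *%R *%R (x \ox x') u))
   (fun u => tmap2 ract *%R (tmap (dif G) id (x \ox x')) u +
    tmap2 lact *%R (x \ox x') (tmap (dif G) id u))) => [y z|y z|y y'].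
  - by rewrite (r2 _).1 ml.1.
  - by rewrite ml.1 (r _).1 (r' _).1 addrACA.
  rewrite tmap2E ?tmapE ?tmap2E //; try
    by [exact: mul_bilinear | exact: lact_bilinear | exact: ract_bilinear].
  by rewrite dif_leibniz tmkDl.
rewrite (r' _).1 -[X in _ + X - _](@tmap2A _ _ _ _ _ _ _ _ *%R lact lact lact);
  last (by move=> x y z; rewrite lactA); try
    by [exact: mul_bilinear | exact: lact_bilinear].
(* the terms containing [(ab) dc] cancel *)
rewrite addrK; symmetry.
apply: tmap2A; last (by move=> x y z; rewrite lractA); try
    by [exact: ract_bilinear | exact: lact_bilinear].
Qed.

(** [psi * w] for a one-form [w]. *)
Definition cform (psi : A -> K) (w : G) : G := slice psi (rcoact G w).

Lemma cform_linear psi : kfunctional psi -> klinear (cform psi).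
Proof.
move=> pl; have sl := slice_linear G pl.
by split=> [x y|k x]; rewrite /cform (rl.1, rl.2) (sl.1, sl.2).
Qed.

Lemma cform_dif psi b : kfunctional psi -> cform psi (dif G b) = dif G (conv psi b).
Proof.
move=> pl; rewrite -[dif G b]lact1 /cform rcoactE coprod1 /conv.
have il : klinear (@id A) by [].
have ml := tmap_linear dl il.
have [l r] := tmap2_bilinear (lact_bilinear G) (mul_bilinear A).
have sl := slice_linear G pl; have sA := slice_linear A pl.
apply: (@tensK_additive_ext K A A _
  (fun t => slice psi (tmap2 lact *%R (1 \ox 1) (tmap (dif G) id t)))
  (fun t => dif G (slice psi t))) => [x y|x y|x y].
- by rewrite ml.1 (r _).1 sl.1.
- by rewrite sA.1 dl.1.
rewrite tmapE // tmap2E; [|exact: lact_bilinear|exact: mul_bilinear].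
by rewrite lact1 mul1r !sliceE // dl.2.
Qed.

End Calculus.

(** * Structure functionals of a left-invariant frame *)

Section Frame.
Variables (K : fieldType) (A : hopfAlgType K) (G : bicov_calculus A).
Variables (N : nat) (F : frame G N).
Local Notation f := (fun_f F).
Local Notation w_ := (omega F).

(** The left coordinates [c_j(w)] of a one-form in the frame. *)
Definition lcoord (w : G) : {ffun 'I_N -> A} := sval (cid (omega_lfree F w)).

Lemma lcoordE w : w = \sum_i lcoord w i >* w_ i.
Proof. by rewrite /lcoord; case: cid => a []. Qed.

Lemma lcoord_sum (a : 'I_N -> A) j : lcoord (\sum_i a i >* w_ i) j = a j.
Proof.
set w := \sum_i _; rewrite /lcoord; case: cid => a' /= [_ /(_ (finfun a))].
have E : w = \sum_i finfun a i >* w_ i by apply: eq_bigr => i _; rewrite ffunE.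
by move=> /(_ E) ->; rewrite ffunE.
Qed.

Lemma lcoordD j : {morph (fun w => lcoord w j) : w w' / w + w'}.
Proof.
move=> w w'; rewrite {1}[w]lcoordE {1}[w']lcoordE -big_split /=.
rewrite (eq_bigr (fun i => (lcoord w i + lcoord w' i) >* w_ i)) ?lcoord_sum //.
by move=> i _; rewrite lactDl.
Qed.

Lemma lcoord_lact a w j : lcoord (a >* w) j = a * lcoord w j.
Proof.
rewrite {1}[w]lcoordE lact_sumr.
rewrite (eq_bigr (fun i => (a * lcoord w i) >* w_ i)) ?lcoord_sum //.
by move=> i _; rewrite lactA.
Qed.

Lemma lcoord_omega i j : lcoord (w_ i) j = (i == j)%:R.
Proof.
rewrite -(lcoord_sum (fun j => (i == j)%:R)) (bigD1 i) //= eqxx lact1.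
rewrite big1 ?addr0 // => k /negPf; rewrite eq_sym => ->; exact: lactl0.
Qed.

Lemma lcoord_ract w a j : lcoord (w *< a) j = \sum_p lcoord w p * conv (f p j) a.
Proof.
rewrite {1}[w]lcoordE ract_suml (morphD_sum (lcoordD j)).
by apply: eq_bigr => p _; rewrite lractA lcoord_lact fun_fE lcoord_sum.
Qed.

Lemma fun_f_functional i j : kfunctional (f i j).
Proof. exact: scalar_kfunctional. Qed.
Local Notation fF := fun_f_functional.
#[local] Hint Resolve fun_f_functional : core.

Lemma conv_fM i j a b :
  conv (f i j) (a * b) = \sum_k conv (f i k) a * conv (f k j) b.
Proof.
have := fun_fE F i (a * b); rewrite -ractA fun_fE.
move=> /(congr1 (fun w => lcoord w j)); rewrite lcoord_sum => <-.
by rewrite lcoord_ract; apply: eq_bigr => k _; rewrite lcoord_sum.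
Qed.

Lemma fun_fM i j a b : f i j (a * b) = \sum_k f i k a * f k j b.
Proof.
rewrite -(counit_conv _ (fF i j)) conv_fM (morphD_sum (counit_kfunctional A).1).
by apply: eq_bigr => k _; rewrite counitM !counit_conv.
Qed.

Local Notation cw i j := (cform (f i j) : G -> G).

Lemma cform_lact i j a (w : G) :
  cw i j (a >* w) = \sum_k conv (f i k) a >* cw k j w.
Proof.
by rewrite /cform rcoact_lact (slice_tmap2 fF fun_fM) //; exact: lact_bilinear.
Qed.

Lemma cform_ract i j (w : G) a :
  cw i j (w *< a) = \sum_k cw i k w *< conv (f k j) a.
Proof.
by rewrite /cform rcoact_ract (slice_tmap2 fF fun_fM) //; exact: ract_bilinear.
Qed.

Lemma cform_omega i j r : cw i j (w_ r) = \sum_q braid F i r q j *: w_ q.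
Proof.
rewrite /cform mat_ME (morphD_sum (slice_linear G (fF i j)).1).
by apply: eq_bigr => q _; rewrite sliceE.
Qed.

(** Obtained by comparing the coefficients of [omega^k] in the coaction of
    [omega^j a = (f^j_i * a) omega^i], which is computed once with the left and
    once with the right module structure. *)
Lemma conv_mat_M j k a :
  \sum_i conv (f j i) a * mat_M F k i =
  \sum_i mat_M F i j * lslice (f i k) (coprod a).
Proof.
have ce := counit_kfunctional A.
pose ck (w : G) := counit (lcoord w k).
have ckl : kfunctional ck.
  split=> [u v|c u]; rewrite /ck; first by rewrite lcoordD ce.1.
  by rewrite -lactK lcoord_lact mulr_algl ce.2.
have ll := lslice_linear A ckl.
have [l r] := tmap2_bilinear (lact_bilinear G) (mul_bilinear A).
have [l' r'] := tmap2_bilinear (ract_bilinear G) (mul_bilinear A).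
transitivity (lslice ck (rcoact G (w_ j *< a))).
  rewrite fun_fE (morphD_sum (linear_klinear (rcoact G)).1) (morphD_sum ll.1).
  apply: eq_bigr => i _; rewrite rcoact_lact mat_ME (morphD_sum (r _).1).
  rewrite (morphD_sum ll.1) (bigD1 k) //= big1 ?addr0 => [|q qk].
    rewrite -[in LHS](counitl (conv (f j i) a)).
    apply: (@tensK_additive_ext K A A _
      (fun t => lslice counit t * mat_M F k i)
      (fun t => lslice ck (tmap2 lact *%R t (w_ k \ox mat_M F k i)))) => [t u|t u|x y].
    - by rewrite (lslice_linear A ce).1 mulrDl.
    - by rewrite (l _).1 ll.1.
    rewrite lsliceE // tmap2E; [|exact: lact_bilinear|exact: mul_bilinear].
    by rewrite lsliceE // /ck lcoord_lact lcoord_omega eqxx mulr1 scalerAl.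
  have := @tensK_additive_ext K A A _
      (fun t => lslice ck (tmap2 lact *%R t (w_ q \ox mat_M F q i))) (fun=> 0).
  apply => [t u|t u|x y]; rewrite ?addr0 // ?(l _).1 ?ll.1 //.
  rewrite tmap2E;  [|exact: lact_bilinear|exact: mul_bilinear].
  rewrite lsliceE // /ck lcoord_lact lcoord_omega (negPf qk) mulr0.
  by rewrite (morphD0 ce.1) scale0r.
rewrite rcoact_ract mat_ME (morphD_sum (l' _).1) (morphD_sum ll.1).
apply: eq_bigr => i _.
apply: (@tensK_additive_ext K A A _
   (fun t => lslice ck (tmap2 ract *%R (w_ i \ox mat_M F i j) t))
   (fun t => mat_M F i j * lslice (f i k) t)) => [t u|t u|x y].
- by rewrite (r' _).1 ll.1.
- by rewrite (lslice_linear A (fF i k)).1 mulrDr.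
rewrite tmap2E; [|exact: ract_bilinear|exact: mul_bilinear].
by rewrite !lsliceE // /ck fun_fE lcoord_sum counit_conv // scalerAr.
Qed.

Local Notation I2 := ('I_N * 'I_N)%type.
(** The entry [Lambda^u_v] for pairs of indices [u] and [v]. *)
Definition braid2 (u v : I2) : K := braid F u.1 u.2 v.1 v.2.
(** The action of the product functional [f^(u_1)_(v_1) f^(u_2)_(v_2)], on
    functions and on one-forms. *)
Definition conv2 (u v : I2) (a : A) : A := conv (f u.1 v.1) (conv (f u.2 v.2) a).
Definition cform2 (u v : I2) (w : G) : G := cw u.1 v.1 (cw u.2 v.2 w).

(** [Lambda] intertwines the products of two structure functionals: the value
    of [f^(u_1)_(w_2)] on both sides of [conv_mat_M]. *)
Lemma braid_fun_f (u w : I2) a :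
  \sum_v braid2 v w * f u.1 v.1 (conv (f u.2 v.2) a) =
  \sum_v braid2 u v * f v.1 w.1 (conv (f v.2 w.2) a).
Proof.
have /(congr1 (f u.1 w.2)) := conv_mat_M u.2 w.1 a.
rewrite !(morphD_sum (fF _ _).1).
under eq_bigr do rewrite fun_fM.
under [in X in _ = X]eq_bigr do rewrite fun_fM.
rewrite exchange_big !pair_bigA /= => E.
transitivity (\sum_p f u.1 p.1 (conv (f u.2 p.2) a) * f p.1 w.2 (mat_M F w.1 p.2)).
  by apply: eq_bigr => v _; rewrite mulrC.
by rewrite E; apply: eq_bigr => v _; rewrite lslice_coprod.
Qed.

Lemma slice_sum (I : finType) (M B : lmodType K) (c : I -> K) (psi : I -> B -> K)
    (t : tensK M B) : (forall i, kfunctional (psi i)) ->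
  \sum_i c i *: slice (psi i) t = slice (fun b => \sum_i c i * psi i b) t.
Proof.
move=> pl.
have sl : kfunctional (fun b => \sum_i c i * psi i b).
  split=> [x y|k x]; rewrite ?mulr_sumr -?big_split; apply: eq_bigr => i _.
    by rewrite (pl i).1 mulrDr.
  by rewrite (pl i).2 mulrCA.
apply: (@tensK_additive_ext K M B _ (fun t => \sum_i c i *: slice (psi i) t)
   (slice (fun b => \sum_i c i * psi i b))) => [x y|x y|x y].
- rewrite -big_split; apply: eq_bigr => i _.
  by rewrite (slice_linear M (pl i)).1 scalerDr.
- exact: (slice_linear M sl).1.
rewrite sliceE // scaler_suml; apply: eq_bigr => i _.
by rewrite sliceE // scalerA.
Qed.

Lemma braid_conv2 (u w : I2) a :
  \sum_v braid2 v w *: conv2 u v a = \sum_v braid2 u v *: conv2 v w a.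
Proof.
have kf i j i' j' : kfunctional (fun b => f i j (conv (f i' j') b)).
  by apply: kfunctional_conv.
rewrite /conv2; under eq_bigr do rewrite conv_conv //.
under [in RHS]eq_bigr do rewrite conv_conv //.
rewrite /conv !slice_sum; try by move=> v; exact: kf.
congr (slice _ _).
by apply/funext => b; exact: braid_fun_f.
Qed.

Lemma cform2_lact (u w : I2) a (x : G) :
  cform2 u w (a >* x) = \sum_v conv2 u v a >* cform2 v w x.
Proof.
rewrite /cform2 cform_lact (morphD_sum (cform_linear G (fF _ _)).1).
under eq_bigr do rewrite cform_lact.
by rewrite exchange_big pair_bigA.
Qed.

Lemma cform2_dif (u w : I2) b : cform2 u w (dif G b) = dif G (conv2 u w b).
Proof. by rewrite /cform2 !cform_dif. Qed.

Lemma cform2_linear u v : klinear (cform2 u v).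
Proof.
have l i j := cform_linear G (fF i j).
by split=> [x y|k x]; rewrite /cform2 ?(l _ _).1 ?(l _ _).2 //.
Qed.

(** The same relation on one-forms.  On [a db] the operator [cform2 u w] is the
    sum over [v] of the [conv2 u v a] times [d(conv2 v w b)], so [Lambda] is moved
    past [b] and then past [a] by [braid_conv2]. *)
Lemma braid_cform2 (u w : I2) (x : G) :
  \sum_v braid2 v w *: cform2 u v x = \sum_v braid2 u v *: cform2 v w x.
Proof.
elim/dif_ind: x => [x y IHx IHy||a b].
- have D (c : I2 -> K) (u' v' : I2 -> I2) :
      \sum_v c v *: cform2 (u' v) (v' v) (x + y) =
      \sum_v c v *: cform2 (u' v) (v' v) x + \sum_v c v *: cform2 (u' v) (v' v) y.
    by rewrite -big_split; apply: eq_bigr => v _; rewrite (cform2_linear _ _).1 scalerDr.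
  by rewrite (D _ (fun=> u) id) (D _ id (fun=> w)) IHx IHy.
- rewrite !big1 // => v _; by rewrite (morphD0 (cform2_linear _ _).1) scaler0.
under eq_bigr do rewrite cform2_lact scaler_sumr.
rewrite exchange_big /=.
transitivity (\sum_s conv2 u s a >* dif G (\sum_v braid2 v w *: conv2 s v b)).
  apply: eq_bigr => s _; rewrite linear_sum lact_sumr; apply: eq_bigr => v _.
  by rewrite cform2_dif linearZ /= lactZr.
transitivity (\sum_v (\sum_s braid2 s v *: conv2 u s a) >* dif G (conv2 v w b)).
  under eq_bigr do rewrite braid_conv2 linear_sum lact_sumr.
  rewrite exchange_big; apply: eq_bigr => v _; rewrite lact_suml.
  by apply: eq_bigr => s _; rewrite linearZ /= lactZr lactZl.
transitivity (\sum_v \sum_s (braid2 u s *: conv2 s v a) >* dif G (conv2 v w b)).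
  apply: eq_bigr => v _; rewrite -lact_suml; congr (_ >* _).
  exact: braid_conv2.
rewrite exchange_big; apply: eq_bigr => v _.
rewrite cform2_lact scaler_sumr; apply: eq_bigr => s _.
by rewrite cform2_dif lactZl.
Qed.

End Frame.

(** * Direct sums of bimodules *)

Section DirectSumTheory.
Variables (K : fieldType) (A : algType K) (T : nat -> bimodType A).
Local Notation D := (dsum T).

Lemma dvalD n (x y : D) : (x + y) n = x n + y n.
Proof. by []. Qed.

Lemma demb_diag n (x : T n) : demb x n = x.
Proof.
rewrite /= /demb_val; case: eqP => // e.
by rewrite (eq_irrelevance e erefl).
Qed.

Lemma demb_neq n k (x : T n) : n != k -> demb x k = 0.
Proof. by rewrite /= /demb_val; case: eqP. Qed.

Lemma demb_morph n (h : forall n, T n -> T n) (h0 : forall n, h n 0 = 0) (x : T n) k :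
  demb (h n x) k = h k (demb x k).
Proof.
by have [<-|nk] := eqVneq n k; rewrite ?demb_diag // !demb_neq.
Qed.

Lemma dembD n : {morph @demb K A T n : x y / x + y}.
Proof.
move=> x y; apply: dsum_ext => k; rewrite dvalD.
by have [<-|nk] := eqVneq n k; rewrite ?demb_diag // !demb_neq // addr0.
Qed.

Lemma dembZ n k (x : T n) : demb (k *: x) = k *: demb x.
Proof.
apply: dsum_ext => j.
by apply: (demb_morph (h := fun n x => k *: x)) => m; apply: scaler0.
Qed.

Lemma demb_lact n a (x : T n) : demb (a >* x) = a >* demb x.
Proof.
apply: dsum_ext => j.
by apply: (demb_morph (h := fun n x => a >* x)) => m; apply: lactr0.
Qed.

Lemma demb_ract n a (x : T n) : demb (x *< a) = demb x *< a.
Proof.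
apply: dsum_ext => j.
by apply: (demb_morph (h := fun n x => x *< a)) => m; apply: ractl0.
Qed.

Lemma dsum_decomp b (x : D) :
  (forall n, (b <= n)%N -> x n = 0) -> x = \sum_(n < b) demb (x n).
Proof.
move=> xb; apply: dsum_ext => k.
rewrite (morphD_sum (f := fun y : D => y k)) //.
have [kb|bk] := ltnP k b; last first.
  rewrite xb // big1 // => i _; rewrite demb_neq //.
  by rewrite neq_ltn (leq_trans (ltn_ord i) bk).
rewrite (bigD1 (Ordinal kb)) //= big1 ?addr0 => [|i ik]; first by rewrite -[RHS]/(demb _ _) demb_diag.
by rewrite -[LHS]/(demb _ _) demb_neq.
Qed.

Lemma dsum_ind (P : D -> Prop) :
  (forall x y, P x -> P y -> P (x + y)) -> (forall n (x : T n), P (demb x)) ->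
  forall x, P x.
Proof.
move=> PD Pe x; have [b xb] := dvalP x; rewrite (dsum_decomp xb).
apply: big_ind => //; by rewrite -(morphD0 (@dembD 0)).
Qed.

Section Extend.
Variable E : forall n, T n -> D.
Hypothesis ED : forall n, {morph @E n : x y / x + y}.

Lemma dsum_extendE b (x : D) : (forall n, (b <= n)%N -> x n = 0) ->
  dsum_extend E x = \sum_(n < b) E (x n).
Proof.
move=> xb; rewrite (fsbig_ord _ b (fun n => E (x n))).
apply: fsbig_widen => n /=.
  by move=> xn; rewrite ltnNge; apply/negP => /xb x0; rewrite x0 eqxx in xn.
by case=> _ /negP; rewrite negbK => /eqP ->; rewrite (morphD0 (@ED n)).
Qed.

Lemma dsum_extendD : {morph dsum_extend E : x y / x + y}.
Proof.
move=> x y; have [b xb] := dvalP x; have [c yc] := dvalP y.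
have xm n : (maxn b c <= n)%N -> x n = 0.
  by rewrite geq_max => /andP[bn _]; apply: xb.
have ym n : (maxn b c <= n)%N -> y n = 0.
  by rewrite geq_max => /andP[_ cn]; apply: yc.
have xym n : (maxn b c <= n)%N -> (x + y) n = 0.
  by move=> h; rewrite dvalD xm // ym // addr0.
rewrite (dsum_extendE xm) (dsum_extendE ym) (dsum_extendE xym) -big_split.
by apply: eq_bigr => n _; rewrite dvalD ED.
Qed.

Lemma dsum_extend_demb n (x : T n) : dsum_extend E (demb x) = E x.
Proof.
have h k : (n.+1 <= k)%N -> demb x k = 0.
  by move=> nk; rewrite demb_neq // neq_ltn nk.
rewrite (dsum_extendE h) big_ord_recr big1 /= => [|i _].
  by rewrite add0r -[demb_val x n]/(demb x n) demb_diag.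
rewrite -[demb_val x i]/(demb x i) demb_neq ?(morphD0 (@ED i)) //.
by rewrite neq_ltn ltn_ord orbT.
Qed.

End Extend.

Lemma dsum_additive_ext (W : zmodType) (g h : D -> W) :
  {morph g : x y / x + y} -> {morph h : x y / x + y} ->
  (forall n (x : T n), g (demb x) = h (demb x)) -> g =1 h.
Proof.
by move=> gD hD gh; elim/dsum_ind => [x y IHx IHy|n x] //; rewrite gD hD IHx IHy.
Qed.

End DirectSumTheory.

(** * Balanced tensor products and tensorfields *)

Section TensorfieldTheory.
Variables (K : fieldType) (A : hopfAlgType K) (G : bicov_calculus A).
Variables (N : nat) (F : frame G N).
Local Notation f := (fun_f F).
Local Notation w_ := (omega F).
Local Notation T := (tensorfield G).
Local Notation tp := (tpow G).
#[local] Hint Resolve fun_f_functional : core.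

Let abal (M P : bimodType A) (W : zmodType) (B : M -> P -> W) :=
  balanced (fun (x : M) (a : A) => x *< a) (fun (a : A) (y : P) => a >* y) B.

Lemma tliftAE (M P : bimodType A) (W : zmodType) (B : M -> P -> W) x y :
  abal B -> tliftA B (x \oxA y) = B x y.
Proof. exact: tens_lift_pure. Qed.

Lemma tliftAD (M P : bimodType A) (W : zmodType) (B : M -> P -> W) :
  abal B -> {morph tliftA B : x y / x + y}.
Proof. by move=> bB x y; apply: tens_liftD. Qed.

Lemma tensA_ind (M P : bimodType A) (Q : tensA M P -> Prop) :
  Q 0 -> (forall t u, Q t -> Q u -> Q (t + u)) ->
  (forall x y, Q (x \oxA y)) -> forall t, Q t.
Proof. exact: tens_ind. Qed.

Lemma tmkA_ract (M P : bimodType A) (x : M) (y : P) a :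
  (x \oxA y : tensA M P) *< a = x \oxA (y *< a).
Proof. exact: tensA_ractE. Qed.
Lemma tmkA_lact (M P : bimodType A) (x : M) (y : P) a :
  a >* (x \oxA y : tensA M P) = (a >* x) \oxA y.
Proof. exact: tensA_lactE. Qed.

Lemma tensA_additive_ext (M P : bimodType A) (W : zmodType) (g h : tensA M P -> W) :
  {morph g : x y / x + y} -> {morph h : x y / x + y} ->
  (forall x y, g (x \oxA y) = h (x \oxA y)) -> g =1 h.
Proof.
move=> gD hD gh t; elim/tensA_ind: t => [|t u IHt IHu|x y] //.
  by rewrite (morphD0 gD) (morphD0 hD).
by rewrite gD hD IHt IHu.
Qed.

Lemma embD n : {morph @emb K A G n : x y / x + y}.
Proof. exact: dembD. Qed.
Lemma emb0 n : emb (0 : tp n) = 0.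
Proof. exact: (morphD0 (@embD n)). Qed.

(** The tensorfield [x (x) w]. *)
Definition snoc (x : T) (w : G) : T :=
  dsum_extend (fun n (x : tp n) => emb (x \oxA w : tp n.+1)) x.

Let snoc_add w n : {morph (fun x : tp n => emb (x \oxA w : tp n.+1)) : x y / x + y}.
Proof. by move=> x y; rewrite tmkADl embD. Qed.

Lemma snoc_emb n (x : tp n) w : snoc (emb x) w = emb (x \oxA w : tp n.+1).
Proof. exact: (dsum_extend_demb (@snoc_add w)). Qed.

Lemma snocDl w : {morph snoc^~ w : x y / x + y}.
Proof. exact: (dsum_extendD (@snoc_add w)). Qed.

Lemma snocDr x : {morph snoc x : w w' / w + w'}.
Proof.
move=> w w'; move: x; apply: dsum_additive_ext.
- exact: snocDl.
- by move=> x y; rewrite !snocDl addrACA.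
by move=> n x; rewrite -!/(emb _) !snoc_emb tmkADr embD.
Qed.

Lemma snoc_bal x a w : snoc (x *< a) w = snoc x (a >* w).
Proof.
move: x; apply: dsum_additive_ext.
- by move=> x y; rewrite ractDl snocDl.
- exact: snocDl.
by move=> n x; rewrite -demb_ract -!/(emb _) !snoc_emb tmkA_bal.
Qed.

Lemma snoc_lact a x w : snoc (a >* x) w = a >* snoc x w.
Proof.
move: x; apply: dsum_additive_ext.
- by move=> x y; rewrite lactDr snocDl.
- by move=> x y; rewrite snocDl lactDr.
by move=> n x; rewrite -demb_lact -!/(emb _) !snoc_emb -demb_lact tmkA_lact.
Qed.

Lemma snoc_ract x w a : snoc x w *< a = snoc x (w *< a).
Proof.
move: x; apply: dsum_additive_ext.
- by move=> x y; rewrite snocDl ractDl.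
- exact: snocDl.
by move=> n x; rewrite -!/(emb _) !snoc_emb -demb_ract tmkA_ract.
Qed.

Lemma snocZl k x w : snoc (k *: x) w = k *: snoc x w.
Proof. by rewrite -!lactK snoc_lact. Qed.
Lemma snocZr k x w : snoc x (k *: w) = k *: snoc x w.
Proof. by rewrite -lactK -snoc_bal ractK snocZl. Qed.

(** [Gamma^(x)(n+1)] is generated by the [x (x) omega^j] with [x] in
    [Gamma^(x)n]: a coefficient in the last factor moves to the left. *)
Lemma tpowS_ind n (P : tp n.+1 -> Prop) :
  P 0 -> (forall t u, P t -> P u -> P (t + u)) ->
  (forall x j, P ((x : tp n) \oxA w_ j)) -> forall t, P t.
Proof.
move=> P0 PD Pw; apply: tensA_ind => // x w.
rewrite [w](lcoordE F) (morphD_sum (tmkADr x)).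
by apply: big_ind => // j _; rewrite -tmkA_bal.
Qed.

End TensorfieldTheory.

Section TensorfieldOps.
Variables (K : fieldType) (A : hopfAlgType K) (G : bicov_calculus A).
Variables (N : nat) (F : frame G N).
Local Notation f := (fun_f F).
Local Notation w_ := (omega F).
Local Notation T := (tensorfield G).
Local Notation tp := (tpow G).
#[local] Hint Resolve fun_f_functional : core.

Lemma tensorfield_additive_ext (W : zmodType) (g h : T -> W) :
  {morph g : x y / x + y} -> {morph h : x y / x + y} ->
  (forall n (x : tp n), g (emb x) = h (emb x)) -> g =1 h.
Proof. exact: dsum_additive_ext. Qed.

Lemma tensorfield_ind (P : T -> Prop) :
  (forall x y, P x -> P y -> P (x + y)) ->
  (forall a : A, P (emb_fun G a)) ->
  (forall x j, P x -> P (snoc x (w_ j))) -> forall x, P x.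
Proof.
move=> PD Pf Ps; apply: dsum_ind => // n; elim: n => [|n IH] x.
  exact: (Pf x).
have P0 : P 0 by rewrite -(emb0 G 0); apply: (Pf 0).
elim/(@tpowS_ind _ _ _ _ F): x => [|t u Pt Pu|x j].
- by have /= := emb0 G n.+1; rewrite /emb => ->.
- by rewrite dembD; apply: PD.
- by have := Ps (emb x) j (IH x); rewrite snoc_emb.
Qed.

Lemma emb_lact n a (x : tp n) : emb (a >* x) = a >* emb x.
Proof. exact: demb_lact. Qed.
Lemma emb_ract n a (x : tp n) : emb (x *< a) = emb x *< a.
Proof. exact: demb_ract. Qed.
Lemma embZ n k (x : tp n) : emb (k *: x) = k *: emb x.
Proof. exact: dembZ. Qed.
Lemma emb_sum n I (r : seq I) (P : pred I) (E : I -> tp n) :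
  emb (\sum_(i <- r | P i) E i) = \sum_(i <- r | P i) emb (E i).
Proof. exact: (morphD_sum (@embD _ _ _ _)). Qed.

Lemma emb_val n (x : tp n) : (emb x : T) n = x.
Proof. exact: demb_diag. Qed.
Lemma emb_inj n : injective (@emb K A G n).
Proof. by move=> x y E; rewrite -[x]emb_val E emb_val. Qed.

(** The grading involution, multiplication by [(-1)^n] in degree [n]. *)
Definition sgn (x : T) : T := dsum_extend (fun n (x : tp n) => emb ((-1) ^+ n *: x)) x.

Let sgn_add n : {morph (fun x : tp n => emb ((-1) ^+ n *: x)) : x y / x + y}.
Proof. by move=> x y; rewrite scalerDr embD. Qed.

Lemma sgn_emb n (x : tp n) : sgn (emb x) = (-1) ^+ n *: emb x.
Proof. by rewrite /sgn (dsum_extend_demb sgn_add) embZ. Qed.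
Lemma sgn_fun (a : A) : sgn (emb_fun G a) = emb_fun G a.
Proof. by rewrite /emb_fun sgn_emb scale1r. Qed.
Lemma sgnD : {morph sgn : x y / x + y}.
Proof. exact: (dsum_extendD sgn_add). Qed.
Lemma sgn_ract x a : sgn (x *< a) = sgn x *< a.
Proof.
move: x; apply: tensorfield_additive_ext.
- by move=> x y; rewrite ractDl sgnD.
- by move=> x y; rewrite sgnD ractDl.
- by move=> n x; rewrite -emb_ract !sgn_emb emb_ract ractZl.
Qed.
Lemma sgn_snoc x w : sgn (snoc x w) = - snoc (sgn x) w.
Proof.
move: x; apply: tensorfield_additive_ext.
- by move=> x y; rewrite snocDl sgnD.
- by move=> x y; rewrite sgnD snocDl opprD.
- by move=> n x; rewrite snoc_emb !sgn_emb snocZl snoc_emb exprS mulN1r scaleNr.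
Qed.

(** * The product of tensorfields *)

(** The two properties are proved together: right linearity in degree [n] makes
    the map defining [tcat] in degree [n+1] balanced. *)
Lemma tcat_ract_add m (x : tp m) n :
  {morph @tcat K A G m x n : y z / y + z} /\
  forall (y : tp n) a, tcat x (y *< a) = tcat x y *< a.
Proof.
elim: n => [|n [D R]].
  split=> [y z|y a] /=; first exact: ractDr.
  by rewrite ractA.
have bal : balanced (fun (y : tp n) (a : A) => y *< a) (fun (a : A) (w : G) => a >* w)
    (fun y w => tcat x y \oxA w : tp (n + m).+1).
  split=> [y y' w|y w w'|y a w]; first by rewrite D tmkADl.
    exact: tmkADr.
  by rewrite R tmkA_bal.
have DS : {morph @tcat K A G m x n.+1 : y z / y + z}.
  exact: (tliftAD bal).
split=> // y a; move: y; apply: tensA_additive_ext.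
- by move=> y z; rewrite ractDl DS.
- by move=> y z; rewrite DS ractDl.
- move=> y w; rewrite tmkA_ract.
  rewrite -[LHS]/(tliftA _ _) -[X in _ = X *< _]/(tliftA _ _) !(tliftAE _ _ bal).
  by rewrite tmkA_ract.
Qed.

Lemma tcatD m (x : tp m) n : {morph @tcat K A G m x n : y z / y + z}.
Proof. exact: (tcat_ract_add x n).1. Qed.
Lemma tcat_ract m (x : tp m) n (y : tp n) a : tcat x (y *< a) = tcat x y *< a.
Proof. exact: (tcat_ract_add x n).2. Qed.

Lemma tcat_pure m (x : tp m) n (y : tp n) w :
  tcat x (y \oxA w : tp n.+1) = tcat x y \oxA w.
Proof.
apply: (tliftAE (B := fun y w => tcat x y \oxA w : tp (n + m).+1)).
split=> [y' y'' w'|y' w' w''|y' a w']; first by rewrite tcatD tmkADl.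
  exact: tmkADr.
by rewrite tcat_ract tmkA_bal.
Qed.

Lemma tcatDl m n (y : tp n) : {morph (fun x : tp m => tcat x y) : x z / x + z}.
Proof.
elim: n y => [|n IH] y x z; first exact: ractDl.
move: y; apply: tensA_additive_ext.
- exact: (@tcatD m (x + z) n.+1).
- by move=> y u; rewrite !(@tcatD m _ n.+1) addrACA.
by move=> y w; rewrite !tcat_pure IH tmkADl.
Qed.

Let mulr_add m (s : tp m) n : {morph (fun t : tp n => emb (tcat s t)) : x y / x + y}.
Proof. by move=> x y; rewrite tcatD embD. Qed.

Let mull_add (y : T) m : {morph (fun s : tp m =>
    dsum_extend (fun n (t : tp n) => emb (tcat s t)) y) : x z / x + z}.
Proof.
move=> x z; move: y; apply: tensorfield_additive_ext.
- exact: (dsum_extendD (mulr_add (x + z))).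
- move=> y y'; rewrite (dsum_extendD (mulr_add x)) (dsum_extendD (mulr_add z)).
  by rewrite addrACA.
- by move=> n y; rewrite !(dsum_extend_demb (mulr_add _)) tcatDl embD.
Qed.

Lemma tens_mul_emb m n (s : tp m) (t : tp n) :
  tens_mul (emb s) (emb t) = emb (tcat s t).
Proof.
by rewrite /tens_mul (dsum_extend_demb (mull_add _)) (dsum_extend_demb (mulr_add s)).
Qed.

Lemma tens_mulDl y : {morph (fun x => tens_mul x y : T) : x z / x + z}.
Proof. exact: (dsum_extendD (mull_add y)). Qed.

Lemma tens_mulDr x : {morph (fun y => tens_mul x y : T) : y z / y + z}.
Proof.
move=> y z; move: x; apply: tensorfield_additive_ext.
- exact: tens_mulDl.
- by move=> x x'; rewrite !tens_mulDl addrACA.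
move=> m x; rewrite /tens_mul !(dsum_extend_demb (mull_add _)).
exact: (dsum_extendD (mulr_add x)).
Qed.

Lemma tens_mul_fun (x : T) (a : A) : tens_mul x (emb_fun G a) = x *< a.
Proof.
move: x; apply: tensorfield_additive_ext.
- exact: tens_mulDl.
- by move=> x y; rewrite ractDl.
by move=> m x; rewrite tens_mul_emb -emb_ract.
Qed.

Lemma tens_mul_snoc (x y : T) (w : G) : tens_mul x (snoc y w) = snoc (tens_mul x y) w.
Proof.
move: x; apply: tensorfield_additive_ext.
- exact: tens_mulDl.
- by move=> x x'; rewrite tens_mulDl snocDl.
move=> m x; move: y; apply: tensorfield_additive_ext.
- by move=> y z; rewrite snocDl tens_mulDr.
- by move=> y z; rewrite tens_mulDr snocDl.
by move=> n y; rewrite snoc_emb !tens_mul_emb tcat_pure snoc_emb.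
Qed.

Lemma tens_mul_ract (x y : T) a : tens_mul x (y *< a) = tens_mul x y *< a.
Proof.
move: x; apply: tensorfield_additive_ext.
- exact: tens_mulDl.
- by move=> x x'; rewrite tens_mulDl ractDl.
move=> m x; move: y; apply: tensorfield_additive_ext.
- by move=> y z; rewrite ractDl tens_mulDr.
- by move=> y z; rewrite tens_mulDr ractDl.
by move=> n y; rewrite -emb_ract !tens_mul_emb tcat_ract emb_ract.
Qed.

Lemma tens_mul0r x : tens_mul x 0 = 0 :> T.
Proof. exact: (morphD0 (tens_mulDr x)). Qed.
Lemma tens_mul0l y : tens_mul 0 y = 0 :> T.
Proof. exact: (morphD0 (tens_mulDl y)). Qed.

Lemma sgn_tens_mul (x y : T) : sgn (tens_mul x y) = tens_mul (sgn x) (sgn y).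
Proof.
elim/tensorfield_ind: y => [y z IHy IHz|a|y j IH].
- by rewrite tens_mulDr !sgnD IHy IHz tens_mulDr.
- by rewrite sgn_fun !tens_mul_fun sgn_ract.
- rewrite tens_mul_snoc !sgn_snoc IH (morphDN (tens_mulDr _)).
  by rewrite tens_mul_snoc.
Qed.

(** * The right coaction on tensorfields *)

(** Compatibility with the right action in degree [n] makes the map defining
    the coaction in degree [n+1] balanced, hence the joint induction. *)
Lemma rcoact_pow_facts n :
  [/\ {morph @rcoact_pow K A G n : x y / x + y},
      (forall k, {morph @rcoact_pow K A G n : x / k *: x}) &
      forall (x : tp n) a,
        rcoact_pow (x *< a) = tmap2 ract *%R (rcoact_pow x) (coprod a)].
Proof.
elim: n => [|n [D Z R]].
  have [D Z] := coprod_klinear A; split=> //= x a.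
  exact: coprodM.
have [tl tr] := tmap2_bilinear (@tmkA_bilinear K A (tp n) G) (mul_bilinear A).
have rl := linear_klinear (rcoact G).
have bal : balanced (fun (y : tp n) (a : A) => y *< a) (fun (a : A) (w : G) => a >* w)
    (fun x w => tmap2 (fun x1 w1 => x1 \oxA w1 : tp n.+1) *%R
        (rcoact_pow x) (rcoact G w)).
  split=> [y y' w|y w w'|y a w]; first by rewrite D (tl _).1.
    by rewrite rl.1 (tr _).1.
  rewrite R rcoact_lact; apply: tmap2A; last (by move=> *; exact: tmkA_bal);
    by [exact: ract_bilinear | exact: tmkA_bilinear | exact: lact_bilinear].
have E (x : tp n) w : rcoact_pow (x \oxA w : tp n.+1) =
    tmap2 (fun x1 w1 => x1 \oxA w1 : tp n.+1) *%R (rcoact_pow x) (rcoact G w).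
  exact: tliftAE.
have DS : {morph @rcoact_pow K A G n.+1 : x y / x + y} by exact: (tliftAD bal).
split=> // [k|x a].
  apply: tensA_additive_ext => [x y|x y|x w].
  - by rewrite scalerDr DS.
  - by rewrite DS scalerDr.
  rewrite -((tmkA_bilinear (tp n) G).1 w).2 !E Z.
  exact: (tl _).2.
have [rrl rrr] := tmap2_bilinear (@ract_bilinear K A (tp n.+1)) (mul_bilinear A).
move: x; apply: tensA_additive_ext => [x y|x y|x w].
- by rewrite ractDl DS.
- by rewrite DS (rrl _).1.
rewrite tmkA_ract !E rcoact_ract; symmetry.
apply: tmap2A; last (by move=> *; rewrite tmkA_ract);
  by [exact: ract_bilinear | exact: tmkA_bilinear].
Qed.

Lemma rcoact_pow_pure n (x : tp n) w : rcoact_pow (x \oxA w : tp n.+1) =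
    tmap2 (fun x1 w1 => x1 \oxA w1 : tp n.+1) *%R (rcoact_pow x) (rcoact G w).
Proof.
have [D Z R] := rcoact_pow_facts n.
have [tl tr] := tmap2_bilinear (@tmkA_bilinear K A (tp n) G) (mul_bilinear A).
have rl := linear_klinear (rcoact G).
apply: (tliftAE (B := fun x w => tmap2 (fun x1 w1 => x1 \oxA w1 : tp n.+1) *%R
        (rcoact_pow x) (rcoact G w))).
split=> [y y' w'|y w' w''|y a w']; first by rewrite D (tl _).1.
  by rewrite rl.1 (tr _).1.
rewrite R rcoact_lact; apply: tmap2A; last (by move=> *; exact: tmkA_bal);
  by [exact: ract_bilinear | exact: tmkA_bilinear | exact: lact_bilinear].
Qed.

Section ConvTens.
Variable psi : A -> K.
Hypothesis pl : kfunctional psi.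

Let ct_add n : {morph (fun x : tp n => emb (slice psi (rcoact_pow x))) : x y / x + y}.
Proof.
have [D _ _] := rcoact_pow_facts n.
by move=> x y; rewrite D (slice_linear _ pl).1 embD.
Qed.

Lemma conv_tens_emb n (x : tp n) :
  conv_tens psi (emb x) = emb (slice psi (rcoact_pow x)).
Proof. exact: (dsum_extend_demb ct_add). Qed.

Lemma conv_tens_fun (a : A) :
  conv_tens psi (emb_fun G a) = emb_fun G (conv psi a).
Proof. exact: conv_tens_emb. Qed.

Lemma conv_tensD : {morph (conv_tens psi : T -> T) : x y / x + y}.
Proof. exact: (dsum_extendD ct_add). Qed.

Lemma conv_tensZ k : {morph (conv_tens psi : T -> T) : x / k *: x}.
Proof.
apply: tensorfield_additive_ext.
- by move=> x y; rewrite scalerDr conv_tensD.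
- by move=> x y; rewrite conv_tensD scalerDr.
move=> n x; have [_ Z _] := rcoact_pow_facts n.
by rewrite -embZ !conv_tens_emb Z (slice_linear _ pl).2 embZ.
Qed.
End ConvTens.

Lemma conv_tens_snoc i j (x : T) w :
  conv_tens (f i j) (snoc x w) =
  \sum_k snoc (conv_tens (f i k) x) (cform (f k j) w).
Proof.
move: x; apply: tensorfield_additive_ext.
- by move=> x y; rewrite snocDl conv_tensD.
- move=> x y; rewrite -big_split; apply: eq_bigr => k _.
  by rewrite conv_tensD // snocDl.
move=> n x; rewrite snoc_emb conv_tens_emb // rcoact_pow_pure.
rewrite (slice_tmap2 (fun_f_functional F) (fun_fM F)); last exact: tmkA_bilinear.
rewrite emb_sum; apply: eq_bigr => k _.
by rewrite conv_tens_emb // snoc_emb.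
Qed.

Lemma sgn_conv_tens i j (x : T) : sgn (conv_tens (f i j) x) = conv_tens (f i j) (sgn x).
Proof.
move: x; apply: tensorfield_additive_ext.
- by move=> x y; rewrite conv_tensD // sgnD.
- by move=> x y; rewrite sgnD conv_tensD.
by move=> n x; rewrite conv_tens_emb // !sgn_emb conv_tensZ // conv_tens_emb.
Qed.

(** * The insertion operators *)

(** The operator [ins_j] on homogeneous tensors.  Its values are taken in the
    direct sum, which avoids predecessors of degrees. *)
Fixpoint ins_pow (n : nat) (j : 'I_N) : tp n -> T :=
  match n return tp n -> T with
  | 0 => fun _ => 0
  | m.+1 => tliftA (fun (x : tp m) (w : G) =>
      (-1) ^+ m *: emb (x *< lcoord F w j) +
      \sum_i snoc (ins_pow i x) (cform (f i j) w))
  end.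

(** The operator [ins_j] on tensorfields. *)
Definition ins (j : 'I_N) (x : T) : T := dsum_extend (fun n (x : tp n) => ins_pow j x) x.

Lemma cformD i j : {morph (cform (f i j) : G -> G) : w w' / w + w'}.
Proof. exact: (cform_linear G (fun_f_functional F i j)).1. Qed.

Let ins_bal n :
  (forall j, {morph @ins_pow n j : x y / x + y}) ->
  (forall j x a, @ins_pow n j (x *< a) = \sum_p ins_pow p x *< conv (f p j) a) ->
  forall j, balanced (fun (y : tp n) (a : A) => y *< a) (fun (a : A) (w : G) => a >* w)
   (fun x w => (-1) ^+ n *: emb (x *< lcoord F w j) +
      \sum_i snoc (ins_pow i x) (cform (f i j) w)).
Proof.
move=> D R j; split=> [x x' w|x w w'|x a w].
- rewrite ractDl embD scalerDr addrACA -big_split; congr (_ + _).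
  by apply: eq_bigr => i _; rewrite D snocDl.
- rewrite lcoordD ractDr embD scalerDr addrACA -big_split; congr (_ + _).
  by apply: eq_bigr => i _; rewrite cformD snocDr.
- rewrite ractA lcoord_lact; congr (_ + _).
  transitivity (\sum_i \sum_p snoc (ins_pow p x) (conv (f p i) a >* cform (f i j) w)).
    apply: eq_bigr => i _; rewrite R (morphD_sum (snocDl _)).
    by apply: eq_bigr => p _; rewrite snoc_bal.
  rewrite exchange_big; apply: eq_bigr => p _.
  by rewrite cform_lact (morphD_sum (snocDr _)).
Qed.

(** The second property in degree [n] makes the map defining [ins_pow] in degree
    [n+1] balanced. *)
Lemma ins_pow_facts n :
  (forall j, {morph @ins_pow n j : x y / x + y}) /\
  (forall j x a, @ins_pow n j (x *< a) = \sum_p ins_pow p x *< conv (f p j) a).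
Proof.
elim: n => [|n [D R]].
  split=> [j x y|j x a] /=; first by rewrite addr0.
  by rewrite big1 // => p _; rewrite ractl0.
have bal := ins_bal D R.
have DS j : {morph @ins_pow n.+1 j : x y / x + y} by exact: (tliftAD (bal j)).
split=> // j x a; move: x; apply: tensA_additive_ext => [x y|x y|x w].
- by rewrite ractDl DS.
- by rewrite -big_split; apply: eq_bigr => p _; rewrite DS ractDl.
rewrite tmkA_ract.
have E j' (x' : tp n) w' : ins_pow j' (x' \oxA w' : tp n.+1) =
    (-1) ^+ n *: emb (x' *< lcoord F w' j') +
      \sum_i snoc (ins_pow i x') (cform (f i j') w').
  exact: (tliftAE _ _ (bal j')).
rewrite E; under [in RHS]eq_bigr do rewrite E ractDl.
rewrite big_split /=; congr (_ + _).
  rewrite lcoord_ract ract_sumr emb_sum scaler_sumr; apply: eq_bigr => p _.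
  by rewrite -ractA emb_ract ractZl.
under [in RHS]eq_bigr do rewrite ract_suml.
rewrite exchange_big; apply: eq_bigr => i _.
rewrite cform_ract (morphD_sum (snocDr _)); apply: eq_bigr => p _.
by rewrite snoc_ract.
Qed.

Let ins_add j n : {morph (fun x : tp n => ins_pow j x) : x y / x + y}.
Proof. exact: (ins_pow_facts n).1. Qed.

Lemma ins_emb j n (x : tp n) : ins j (emb x) = ins_pow j x.
Proof. exact: (dsum_extend_demb (ins_add j)). Qed.

Lemma insD j : {morph ins j : x y / x + y}.
Proof. exact: (dsum_extendD (ins_add j)). Qed.

Lemma ins_fun j (a : A) : ins j (emb_fun G a) = 0.
Proof. exact: ins_emb. Qed.

Lemma ins_snoc j x w :
  ins j (snoc x w) = sgn x *< lcoord F w j + \sum_i snoc (ins i x) (cform (f i j) w).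
Proof.
move: x; apply: tensorfield_additive_ext.
- by move=> x y; rewrite snocDl insD.
- move=> x y; rewrite sgnD ractDl addrACA -big_split; congr (_ + _).
  by apply: eq_bigr => i _; rewrite insD snocDl.
move=> n x; have [D R] := ins_pow_facts n.
rewrite snoc_emb ins_emb; have := tliftAE x w (ins_bal D R j).
rewrite -[tliftA _ _]/(ins_pow j (x \oxA w : tp n.+1)) => ->.
rewrite sgn_emb emb_ract ractZl; congr (_ + _).
by apply: eq_bigr => i _; rewrite ins_emb.
Qed.

Lemma ins_ract j x a : ins j (x *< a) = \sum_p ins p x *< conv (f p j) a.
Proof.
move: x; apply: tensorfield_additive_ext.
- by move=> x y; rewrite ractDl insD.
- by move=> x y; rewrite -big_split; apply: eq_bigr => p _; rewrite insD ractDl.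
move=> n x; rewrite -emb_ract ins_emb (ins_pow_facts n).2.
by apply: eq_bigr => p _; rewrite ins_emb.
Qed.

Lemma sgn_lact a x : sgn (a >* x) = a >* sgn x.
Proof.
move: x; apply: tensorfield_additive_ext.
- by move=> x y; rewrite lactDr sgnD.
- by move=> x y; rewrite sgnD lactDr.
- by move=> n x; rewrite -emb_lact !sgn_emb emb_lact lactZr.
Qed.

Lemma ins_lact j x a : ins j (a >* x) = a >* ins j x.
Proof.
elim/tensorfield_ind: x j => [x y IHx IHy|b|x i IH] j.
- by rewrite lactDr !insD IHx IHy lactDr.
- rewrite ins_fun lactr0 /emb_fun -emb_lact; exact: ins_fun.
rewrite -snoc_lact !ins_snoc sgn_lact lactDr lractA lact_sumr; congr (_ + _).
by apply: eq_bigr => k _; rewrite IH snoc_lact.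
Qed.

(** Property (d') for the tensor product, by induction on the second factor. *)
Lemma ins_tens_mul j (x y : T) :
  ins j (tens_mul x y) =
  \sum_i tens_mul (ins i x) (conv_tens (f i j) y) + tens_mul (sgn x) (ins j y).
Proof.
elim/tensorfield_ind: y j => [y z IHy IHz|a|y k IH] j.
- rewrite tens_mulDr !insD IHy IHz tens_mulDr addrACA -big_split; congr (_ + _).
  by apply: eq_bigr => i _; rewrite conv_tensD // tens_mulDr.
- rewrite ins_fun tens_mul0r addr0 tens_mul_fun ins_ract.
  by apply: eq_bigr => i _; rewrite conv_tens_fun // tens_mul_fun.
rewrite tens_mul_snoc !ins_snoc sgn_tens_mul tens_mulDr tens_mul_ract.
rewrite addrCA; congr (_ + _).
under eq_bigr do rewrite IH snocDl (morphD_sum (snocDl _)).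
rewrite big_split /= (morphD_sum (tens_mulDr _)); congr (_ + _).
  rewrite exchange_big; apply: eq_bigr => i _.
  rewrite conv_tens_snoc (morphD_sum (tens_mulDr _)); apply: eq_bigr => p _.
  by rewrite tens_mul_snoc.
by apply: eq_bigr => i _; rewrite tens_mul_snoc.
Qed.

(** The exchange of [ins_q] with [f^k_l *]; the induction step is
    [braid_cform2] in the last factor. *)
Lemma ins_conv_tens k l q (x : T) :
  ins q (conv_tens (f k l) x) =
  \sum_v braid2 F v (q, l) *: conv_tens (f k v.1) (ins v.2 x).
Proof.
elim/tensorfield_ind: x k l q => [x y IHx IHy|a|x s IH] k l q.
- rewrite conv_tensD // !insD IHx IHy -big_split; apply: eq_bigr => v _.
  by rewrite insD conv_tensD // scalerDr.
- rewrite conv_tens_fun // ins_fun big1 // => v _.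
  by rewrite ins_fun (morphD0 (conv_tensD (fun_f_functional F _ _))) scaler0.
rewrite conv_tens_snoc (morphD_sum (@insD q)).
under eq_bigr do rewrite ins_snoc.
under [in RHS]eq_bigr do rewrite ins_snoc conv_tensD // scalerDr.
rewrite !big_split /=; congr (_ + _).
  (* the terms taking the last coordinate: only [r = s] survives *)
  rewrite -(pair_bigA _ (fun p r => braid2 F (p, r) (q, l) *:
    conv_tens (f k p) (sgn x *< lcoord F (w_ s) r))) /=.
  apply: eq_bigr => p _; rewrite (bigD1 s) //= big1 ?addr0 => [|r rs].
    rewrite lcoord_omega eqxx ract1 sgn_conv_tens.
    have -> : lcoord F (cform (f p l) (w_ s)) q = (braid F p s q l)%:A.
      rewrite cform_omega (eq_bigr (fun r => (braid F p s r l)%:A >* w_ r)).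
        by rewrite lcoord_sum.
      by move=> r _; rewrite lactK.
    by rewrite ractK.
  rewrite lcoord_omega eq_sym (negPf rs) ractr0.
  by rewrite (morphD0 (conv_tensD (fun_f_functional F _ _))) scaler0.
(* the other terms: the induction hypothesis leaves [Lambda] acting on the
   last factor, where it passes through the two convolutions *)
transitivity (\sum_v snoc (conv_tens (f k v.1) (ins v.2 x))
   (\sum_u braid2 F v u *: cform2 F u (q, l) (w_ s))).
  transitivity (\sum_(u : 'I_N * 'I_N) \sum_v
     snoc (conv_tens (f k v.1) (ins v.2 x)) (braid2 F v u *: cform2 F u (q, l) (w_ s))).
    rewrite -(pair_bigA _ (fun i p => \sum_v
     snoc (conv_tens (f k v.1) (ins v.2 x))
       (braid2 F v (i, p) *: cform2 F (i, p) (q, l) (w_ s)))) exchange_big /=.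
    apply: eq_bigr => p _; apply: eq_bigr => i _.
    rewrite IH (morphD_sum (snocDl _)); apply: eq_bigr => v _.
    by rewrite snocZl snocZr.
  rewrite exchange_big; apply: eq_bigr => v _.
  by rewrite (morphD_sum (snocDr _)).
transitivity (\sum_v \sum_u braid2 F u (q, l) *:
   snoc (conv_tens (f k v.1) (ins v.2 x)) (cform2 F v u (w_ s))).
  apply: eq_bigr => v _.
  transitivity (snoc (conv_tens (f k v.1) (ins v.2 x))
    (\sum_u braid2 F u (q, l) *: cform2 F v u (w_ s))).
    by congr (snoc _ _); symmetry; apply: braid_cform2.
  rewrite (morphD_sum (snocDr _)).
  by apply: eq_bigr => u _; rewrite snocZr.
rewrite exchange_big; apply: eq_bigr => u _.
rewrite -scaler_sumr; congr (_ *: _).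
rewrite (morphD_sum (conv_tensD (fun_f_functional F _ _))).
rewrite -(pair_bigA _ (fun a b => snoc (conv_tens (f k a) (ins b x))
   (cform2 F (a, b) u (w_ s)))) exchange_big.
by apply: eq_bigr => b _; rewrite conv_tens_snoc.
Qed.

End TensorfieldOps.

(** * Multi-indices and the recursion of the shuffle matrices *)

Section MultiIndex.
Variable N : nat.

(** The multi-index [k] extended by a last index [j]. *)
Definition midx_snoc n (k : midx N n) (j : 'I_N) : midx N n.+1 :=
  [ffun r => if unlift ord_max r is Some r' then k r' else j].

Lemma widen_ord_lift n (r : 'I_n) : widen_ord (leqnSn n) r = lift ord_max r.
Proof. by apply: val_inj; rewrite /= /bump leqNgt ltn_ord. Qed.

Lemma midx_init_snoc n (k : midx N n) j : midx_init (midx_snoc k j) = k.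
Proof. by apply/ffunP => r; rewrite !ffunE widen_ord_lift liftK. Qed.

Lemma midx_last_snoc n (k : midx N n) j : midx_last (midx_snoc k j) = j.
Proof. by rewrite /midx_last ffunE unlift_none. Qed.

Lemma midx_snocK n (i : midx N n.+1) : midx_snoc (midx_init i) (midx_last i) = i.
Proof.
apply/ffunP => r; rewrite ffunE; case: unliftP => [r'|] ->.
  by rewrite ffunE widen_ord_lift.
by [].
Qed.

Lemma midx_eq n (i j : midx N n.+1) :
  (i == j) = (midx_init i == midx_init j) && (midx_last i == midx_last j).
Proof.
apply/eqP/andP => [->|[/eqP e1 /eqP e2]]; first by rewrite !eqxx.
by rewrite -(midx_snocK i) e1 e2 midx_snocK.
Qed.

Lemma midx0_eq (i j : midx N 0) : i = j.
Proof. by apply/ffunP; case. Qed.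

Lemma sum_midx (V : nmodType) n (E : midx N n.+1 -> V) :
  \sum_i E i = \sum_k \sum_j E (midx_snoc k j).
Proof.
rewrite pair_bigA /=.
rewrite (reindex (fun p : midx N n * 'I_N => midx_snoc p.1 p.2)) //.
exists (fun i => (midx_init i, midx_last i)) => [[k j]|i] _ /=.
  by rewrite midx_init_snoc midx_last_snoc.
exact: midx_snocK.
Qed.

End MultiIndex.

(** Matrix multiplication is a monoid law, for the ordered products of
    braidings. *)
HB.instance Definition _ (K : fieldType) (n : nat) :=
  Monoid.isLaw.Build 'M[K]_n 1%:M mulmx (fun X Y Z => mulmxA X Y Z)
    (fun X => mul1mx X) (fun X => mulmx1 X).

Section MultiIndexMatrix.
Variables (K : fieldType) (N : nat).
Local Notation mx n := 'M[K]_#|{: midx N n}|.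

Lemma ient_imx n (E : midx N n -> midx N n -> K) i j : ient (imx E) i j = E i j.
Proof. by rewrite /ient mxE !enum_rankK. Qed.

Lemma ient_inj n (X Y : mx n) : (forall i j, ient X i j = ient Y i j) -> X = Y.
Proof.
move=> E; apply/matrixP => r s; have := E (enum_val r) (enum_val s).
by rewrite /ient !enum_valK.
Qed.

Lemma ientM n (X Y : mx n) i j : ient (X *m Y) i j = \sum_k ient X i k * ient Y k j.
Proof.
rewrite /ient mxE (reindex (@enum_rank (midx N n))) //.
exists enum_val => k _; by rewrite (enum_rankK, enum_valK).
Qed.

Lemma ient1 n i j : ient (1%:M : mx n) i j = (i == j)%:R.
Proof. by rewrite /ient mxE (inj_eq enum_rank_inj). Qed.

Lemma ientD n (X Y : mx n) i j : ient (X + Y) i j = ient X i j + ient Y i j.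
Proof. by rewrite /ient mxE. Qed.

Lemma ientN n (X : mx n) i j : ient (- X) i j = - ient X i j.
Proof. by rewrite /ient mxE. Qed.

Lemma ientZ n c (X : mx n) i j : ient (c *: X) i j = c * ient X i j.
Proof. by rewrite /ient mxE. Qed.

(** The matrix [X (x) 1], acting as [X] on all factors but the last. *)
Definition ext_mx n (X : mx n) : mx n.+1 :=
  imx (fun i j => ient X (midx_init i) (midx_init j) *
                  (midx_last i == midx_last j)%:R).

Lemma ext_mxM n : {morph @ext_mx n : X Y / X *m Y}.
Proof.
move=> X Y; apply: ient_inj => i j; rewrite ient_imx !ientM sum_midx mulr_suml.
apply: eq_bigr => k _; rewrite (bigD1 (midx_last i)) //= big1 ?addr0 => [|s si].
  by rewrite !ient_imx midx_init_snoc midx_last_snoc eqxx mulr1 mulrA.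
by rewrite !ient_imx midx_last_snoc eq_sym (negPf si) mulr0 mul0r.
Qed.

Lemma ext_mx1 n : ext_mx 1%:M = 1%:M :> mx n.+1.
Proof.
apply: ient_inj => i j; rewrite ient_imx !ient1 midx_eq.
by case: eqP; case: eqP; rewrite ?mulr0 ?mul0r ?mulr1.
Qed.

Lemma ext_mxD n : {morph @ext_mx n : X Y / X + Y}.
Proof. by move=> X Y; apply: ient_inj => i j; rewrite ientD !ient_imx ientD mulrDl. Qed.

Lemma ext_mxZ n c : {morph @ext_mx n : X / c *: X}.
Proof. by move=> X; apply: ient_inj => i j; rewrite ientZ !ient_imx ientZ mulrA. Qed.

End MultiIndexMatrix.

Section BraidMatrix.
Variables (K : fieldType) (A : hopfAlgType K) (G : bicov_calculus A).
Variables (N : nat) (F : frame G N).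

Lemma braid_mxE n m (i j : midx N n.+1) :
  ient (braid_mx F n m) i j =
  braid F (i (inord m)) (i (inord m.+1)) (j (inord m)) (j (inord m.+1)) *
  [forall k, (k != inord m) && (k != inord m.+1) ==> (i k == j k)]%:R.
Proof. exact: ient_imx. Qed.

Lemma widen_inord n m : (m < n.+1)%N ->
  widen_ord (leqnSn n.+1) (inord m : 'I_n.+1) = inord m :> 'I_n.+2.
Proof. by move=> mn; apply: val_inj; rewrite /= !inordK // ltnW. Qed.

Lemma midx_init_inord n m (i : midx N n.+2) : (m < n.+1)%N ->
  midx_init i (inord m) = i (inord m).
Proof. by move=> mn; rewrite ffunE widen_inord. Qed.

Lemma ext_braid_mx n m : (m < n)%N -> ext_mx (braid_mx F n m) = braid_mx F n.+1 m.
Proof.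
move=> mn; apply: ient_inj => i j; rewrite ient_imx !braid_mxE.
have m1 : (m < n.+1)%N by rewrite ltnW.
rewrite !midx_init_inord // -mulrA -natrM mulnb; congr (_ * (nat_of_bool _)%:R).
apply/andP/forallP => [[/forallP H /eqP e] k|H].
  apply/implyP => /andP[kp kq].
  case: (unliftP ord_max k) => [k'|] ek; last by rewrite ek; apply/eqP.
  have := H k'; rewrite !ffunE widen_ord_lift -ek => /implyP; apply.
  rewrite ek in kp kq.
  by apply/andP; split; [apply: contraNneq kp => -> | apply: contraNneq kq => ->];
    rewrite -widen_ord_lift widen_inord.
split; last first.
  have /implyP := H ord_max; apply.
  rewrite -!(inj_eq val_inj) /= !inordK; try by [apply: ltnW | rewrite ltnS ltnW].
  by rewrite !gtn_eqF // ltnS.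
apply/forallP => k; rewrite !ffunE widen_ord_lift.
apply/implyP => /andP[kp kq]; apply: (implyP (H (lift ord_max k))).
by rewrite -!widen_inord // !widen_ord_lift !(inj_eq (@lift_inj _ _)) kp kq.
Qed.

Lemma ient_braid_last n (i j : midx N n.+2) :
  ient (braid_mx F n.+1 n) i j =
  braid F (midx_last (midx_init i)) (midx_last i) (midx_last (midx_init j)) (midx_last j)
  * (midx_init (midx_init i) == midx_init (midx_init j))%:R.
Proof.
rewrite braid_mxE.
have -> : inord n.+1 = ord_max :> 'I_n.+2 by apply: val_inj; rewrite /= inordK.
have -> : inord n = widen_ord (leqnSn n.+1) ord_max :> 'I_n.+2.
  by apply: val_inj; rewrite /= inordK.
rewrite /midx_last [midx_init i ord_max]ffunE [midx_init j ord_max]ffunE.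
congr (_ * (nat_of_bool _)%:R).
apply/forallP/eqP => [H|H k].
  apply/ffunP => r; rewrite !ffunE; apply/eqP; apply: (implyP (H _)).
  by rewrite -!(inj_eq val_inj) /= !ltn_eqF // ltnS ltnW.
apply/implyP => /andP[kp kq].
case: (unliftP ord_max k) => [k'|] ek; last by rewrite ek eqxx in kq.
rewrite ek -widen_ord_lift in kp *.
case: (unliftP ord_max k') => [k''|] ek'; last by rewrite ek' eqxx in kp.
rewrite ek' -widen_ord_lift.
by move/ffunP: H => /(_ k''); rewrite !ffunE => ->.
Qed.

Lemma shuffle_mx_sum n : shuffle_mx F n =
  \sum_(0 <= k < n.+1) (-1) ^+ k *: \big[mulmx/1%:M]_(n - k <= m < n) braid_mx F n m.
Proof. by rewrite big_ltn // subn0 (big_geq (leqnn n)) expr0 scale1r. Qed.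

(** [I_(n+1) = 1 - (I_n (x) 1) Lambda_(n,n+1)]: all products of braidings except
    the empty one end in the same factor. *)
Lemma shuffle_mxS n :
  shuffle_mx F n.+1 = 1%:M - ext_mx (shuffle_mx F n) *m braid_mx F n.+1 n.
Proof.
rewrite shuffle_mx_sum big_nat_recl // subn0 (big_geq (leqnn n.+1)) expr0.
rewrite scale1r; congr (_ + _).
rewrite shuffle_mx_sum (morphD_sum (@ext_mxD K N n.+1)) mulmx_suml -sumrN.
apply: eq_bigr => k _; rewrite subSS big_nat_recr ?leq_subr //=.
rewrite exprS mulN1r scaleNr ext_mxZ -scalemxAl; congr (- (_ *: (_ *m _))).
rewrite (big_morph _ (@ext_mxM K N n.+1) (@ext_mx1 K N n.+1)).
rewrite big_nat [RHS]big_nat; apply: eq_bigr => m /andP[_ mn].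
by rewrite ext_braid_mx.
Qed.

End BraidMatrix.

(** * Freeness of the tensor powers *)

Section Coordinates.
Variables (K : fieldType) (A : hopfAlgType K) (G : bicov_calculus A).
Variables (N : nat) (F : frame G N).
Local Notation f := (fun_f F).
Local Notation w_ := (omega F).
Local Notation T := (tensorfield G).
Local Notation tp := (tpow G).
Local Notation tb := (tbasis F).
#[local] Hint Resolve fun_f_functional : core.

(** The map [x (x) w |-> x c_j(w)], the coefficient of [omega^j] in the last
    factor. *)
Definition last_coord n (j : 'I_N) : tp n.+1 -> tp n :=
  tliftA (fun (x : tp n) (w : G) => x *< lcoord F w j).

Let lc_bal n j : balanced (fun (y : tp n) (a : A) => y *< a)
  (fun (a : A) (w : G) => a >* w) (fun x w => x *< lcoord F w j).
Proof.
split=> [x x' w|x w w'|x a w]; first exact: ractDl.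
  by rewrite lcoordD ractDr.
by rewrite lcoord_lact ractA.
Qed.

Lemma last_coord_pure n j (x : tp n) w :
  last_coord j (x \oxA w : tp n.+1) = x *< lcoord F w j.
Proof. exact: (tliftAE _ _ (@lc_bal n j)). Qed.

Lemma last_coordD n j : {morph @last_coord n j : x y / x + y}.
Proof. exact: (tliftAD (@lc_bal n j)). Qed.

Lemma last_coord_lact n j a (x : tp n.+1) : last_coord j (a >* x) = a >* last_coord j x.
Proof.
move: x; apply: tensA_additive_ext => [x y|x y|x w].
- by rewrite lactDr last_coordD.
- by rewrite last_coordD lactDr.
- by rewrite tmkA_lact !last_coord_pure lractA.
Qed.

Lemma last_coord_tbasis n j (i : midx N n.+1) :
  last_coord j (tb i) = (midx_last i == j)%:R *: tb (midx_init i).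
Proof.
rewrite last_coord_pure lcoord_omega.
by case: eqP => _; rewrite ?ract1 ?scale1r ?ractr0 ?scale0r.
Qed.

Lemma tpow0_tbasis (a : tp 0) (i : midx N 0) : a = (a : A) >* tb i.
Proof. by rewrite /= /lact /= mulr1. Qed.

Lemma sum_midx0 (V : nmodType) (E : midx N 0 -> V) i : \sum_k E k = E i.
Proof.
by rewrite (bigD1 i) //= big1 ?addr0 // => k /eqP[]; apply: midx0_eq.
Qed.

Lemma tbasis_free n (a b : midx N n -> A) :
  \sum_i a i >* tb i = \sum_i b i >* tb i -> a =1 b.
Proof.
elim: n a b => [|n IH] a b E i.
  by move: E; rewrite !(sum_midx0 _ i) /lact /= !mulr1.
rewrite -(midx_snocK i); move: (midx_init i) (midx_last i) => {i} k j.
apply: (IH (fun k => a (midx_snoc k j)) (fun k => b (midx_snoc k j))).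
have H (c : midx N n.+1 -> A) : last_coord j (\sum_i c i >* tb i) =
    \sum_k c (midx_snoc k j) >* tb k.
  rewrite (morphD_sum (@last_coordD n j)) sum_midx; apply: eq_bigr => l _.
  rewrite (bigD1 j) //= big1 ?addr0 => [|s sj]; rewrite last_coord_lact last_coord_tbasis
     midx_last_snoc midx_init_snoc.
    by rewrite eqxx scale1r.
  by rewrite (negPf sj) scale0r lactr0.
by rewrite -!H E.
Qed.

Lemma tbasis_span n (x : tp n) :
  exists a : {ffun midx N n -> A}, x = \sum_i a i >* tb i.
Proof.
elim: n x => [|n IH] x.
  exists [ffun=> x]; rewrite (sum_midx0 _ (ffun0 (card_ord 0))).
  by rewrite ffunE -tpow0_tbasis.
elim/(@tpowS_ind _ _ _ _ F): x => [|t u [a ->] [b ->]|x j].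
- by exists 0; rewrite big1 // => i _; rewrite ffunE lactl0.
- exists (a + b); rewrite -big_split; apply: eq_bigr => i _.
  by rewrite ffunE lactDl.
have [a ->] := IH x.
exists [ffun i : midx N n.+1 => a (midx_init i) * (midx_last i == j)%:R].
rewrite (morphD_sum (fun x y => tmkADl x y _)) sum_midx; apply: eq_bigr => k _.
rewrite (bigD1 j) //= big1 ?addr0 => [|s sj]; rewrite ffunE midx_last_snoc midx_init_snoc.
  by rewrite eqxx mulr1 -tmkA_lact.
by rewrite (negPf sj) mulr0 lactl0.
Qed.

Lemma tcoefE n (x : tp n) : x = \sum_i tcoef F x i >* tb i.
Proof.
have [a E] := tbasis_span x.
by have := @xgetPex _ 0 [set a : {ffun midx N n -> A} | x = \sum_i a i >* tb i]%classic
  (ex_intro _ a E).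
Qed.

Lemma tcoef_sum n (a : midx N n -> A) i : tcoef F (\sum_i a i >* tb i) i = a i.
Proof. by have /tbasis_free/(_ i) := esym (tcoefE (\sum_i a i >* tb i)). Qed.

Lemma tcoefD n i : {morph (fun x : tp n => tcoef F x i) : x y / x + y}.
Proof.
move=> x y; rewrite {1}[x]tcoefE {1}[y]tcoefE -big_split /=.
rewrite (eq_bigr (fun i => (tcoef F x i + tcoef F y i) >* tb i)) ?tcoef_sum //.
by move=> k _; rewrite lactDl.
Qed.

Lemma tcoef_lact n a (x : tp n) i : tcoef F (a >* x) i = a * tcoef F x i.
Proof.
rewrite {1}[x]tcoefE lact_sumr.
rewrite (eq_bigr (fun i => (a * tcoef F x i) >* tb i)) ?tcoef_sum //.
by move=> k _; rewrite lactA.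
Qed.

Lemma left_linear_ext (M : bimodType A) n (g h : tp n -> M) :
  {morph g : x y / x + y} -> (forall a x, g (a >* x) = a >* g x) ->
  {morph h : x y / x + y} -> (forall a x, h (a >* x) = a >* h x) ->
  (forall i, g (tb i) = h (tb i)) -> g =1 h.
Proof.
move=> gD gL hD hL gh x; rewrite [x]tcoefE (morphD_sum gD) (morphD_sum hD).
by apply: eq_bigr => i _; rewrite gL hL gh.
Qed.

(** * Antisymmetrization *)

(** The homogeneous components of [altern]. *)
Definition altern_pow n (x : tp n) : tp n := \sum_i tcoef F x i >* wbasis F i.

Let ap_add n : {morph (fun x : tp n => emb (altern_pow x)) : x y / x + y}.
Proof.
move=> x y; rewrite -embD -big_split; congr (emb _); apply: eq_bigr => i _.
by rewrite tcoefD lactDl.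
Qed.

Lemma altern_emb n (x : tp n) : altern F (emb x) = emb (altern_pow x).
Proof. exact: (dsum_extend_demb ap_add). Qed.

Lemma alternD : {morph altern F : x y / x + y}.
Proof. exact: (dsum_extendD ap_add). Qed.

Lemma altern_lact a x : altern F (a >* x) = a >* altern F x.
Proof.
move: x; apply: tensorfield_additive_ext => [x y|x y|n x].
- by rewrite lactDr alternD.
- by rewrite alternD lactDr.
rewrite -emb_lact !altern_emb -emb_lact lact_sumr; congr (emb _).
by apply: eq_bigr => i _; rewrite tcoef_lact lactA.
Qed.

Lemma altern0 : altern F 0 = 0.
Proof. exact: (morphD0 alternD). Qed.
Lemma alternZ k x : altern F (k *: x) = k *: altern F x.
Proof. by rewrite -!lactK altern_lact. Qed.

Lemma altern_tbasis n (i : midx N n) : altern F (emb (tb i)) = emb (wbasis F i).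
Proof.
have E : tb i = \sum_k (k == i)%:R >* tb k.
  rewrite (bigD1 i) //= eqxx lact1 big1 ?addr0 // => k /negPf ->.
  by rewrite lactl0.
rewrite altern_emb /altern_pow (bigD1 i) //= big1 ?addr0 => [|k ki].
  by rewrite {1}E tcoef_sum eqxx lact1.
by rewrite E tcoef_sum (negPf ki) lactl0.
Qed.

Lemma altern_fun (a : A) : altern F (emb_fun G a) = emb_fun G a.
Proof.
pose i : midx N 0 := ffun0 (card_ord 0).
rewrite /emb_fun (tpow0_tbasis a i) emb_lact altern_lact altern_tbasis.
by rewrite /wbasis (sum_midx0 _ i) ient1 eqxx scale1r.
Qed.

Lemma wbasisS n (i : midx N n.+1) :
  wbasis F i = \sum_k ient (shuffle_mx F n) i k *:
     (wbasis F (midx_init k) \oxA w_ (midx_last k) : tp n.+1).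
Proof.
have [lb rb] := tmkA_bilinear (tp n) G.
rewrite /wbasis.
transitivity (\sum_j \sum_k (ient (shuffle_mx F n) i k *
    (ient (alt_mx F n) (midx_init k) (midx_init j) *
     (midx_last k == midx_last j)%:R)) *: tb j).
  apply: eq_bigr => j _; rewrite -scaler_suml [alt_mx F n.+1]/=.
  by rewrite ientM; under eq_bigr do rewrite ient_imx.
rewrite exchange_big; apply: eq_bigr => k _.
under eq_bigr do rewrite -scalerA.
rewrite -scaler_sumr (morphD_sum (lb _).1) sum_midx; congr (_ *: _).
apply: eq_bigr => l _; rewrite (bigD1 (midx_last k)) //= big1 ?addr0 => [|s sk].
  by rewrite midx_init_snoc midx_last_snoc eqxx mulr1 (lb _).2.
by rewrite midx_last_snoc eq_sym (negPf sk) mulr0 scale0r.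
Qed.

(** The operators [ins_j] are the shuffle matrices, up to sign. *)
Lemma ins_tbasis n j (i : midx N n.+1) :
  ins F j (emb (tb i)) = (-1) ^+ n *: \sum_k
     (ient (shuffle_mx F n) i k * (midx_last k == j)%:R) *: emb (tb (midx_init k)).
Proof.
elim: n j i => [|n IH] j i.
  have -> : shuffle_mx F 0 = 1%:M by rewrite /shuffle_mx big_geq // addr0.
  rewrite scale1r -snoc_emb ins_snoc big1 ?addr0 => [|p _]; last first.
    by rewrite -/(emb_fun G 1) ins_fun (morphD0 (snocDl _)).
  rewrite (bigD1 i) //= big1 ?addr0 => [|k ki].
    rewrite ient1 eqxx mul1r lcoord_omega sgn_emb scale1r.
    by case: eqP => _; rewrite ?ract1 ?scale1r ?ractr0 ?scale0r.
  by rewrite ient1 eq_sym (negPf ki) mul0r scale0r.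
set i' := midx_init i; set r := midx_last i.
have [lb rb] := tmkA_bilinear (tp n) G.
have -> : emb (tb i) = snoc (emb (tb i')) (w_ r) by rewrite snoc_emb.
rewrite ins_snoc sgn_emb.
pose X l q := emb (tb l \oxA w_ q : tp n.+1).
transitivity ((-1) ^+ n.+1 *: ((r == j)%:R *: emb (tb i') -
   \sum_l ient (shuffle_mx F n) i' l *:
      \sum_q braid F (midx_last l) r q j *: X (midx_init l) q)).
  rewrite lcoord_omega scalerBr; congr (_ + _).
    by case: eqP => _; rewrite ?ract1 ?scale1r ?ractr0 ?scale0r ?scaler0.
  rewrite exprS mulN1r scaleNr opprK.
  under eq_bigr do rewrite IH snocZl cform_omega (morphD_sum (snocDl _)).
  rewrite -scaler_sumr exchange_big; congr (_ *: _); apply: eq_bigr => l _.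
  rewrite (bigD1 (midx_last l)) //= [X in _ + X]big1 ?addr0 => [|p pl].
    rewrite eqxx mulr1 snocZl (morphD_sum (snocDr _)); congr (_ *: _).
    by apply: eq_bigr => q _; rewrite snocZr snoc_emb.
  by rewrite eq_sym (negPf pl) mulr0 snocZl scale0r.
(* it remains to expand the recursion of the shuffle matrix; a multi-index is
   split into its last entries, and the Kronecker deltas select one term *)
congr (_ *: _); rewrite shuffle_mxS.
under [in RHS]eq_bigr do rewrite ientD ientN mulrBl scalerBl.
rewrite sumrB; congr (_ - _).
  rewrite (bigD1 i) //= big1 ?addr0 => [|k ki]; first by rewrite ient1 eqxx mul1r.
  by rewrite ient1 eq_sym (negPf ki) mul0r scale0r.
transitivity (\sum_k \sum_l' (ient (ext_mx (shuffle_mx F n)) i l' *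
   ient (braid_mx F n.+1 n) l' k * (midx_last k == j)%:R) *: emb (tb (midx_init k)));
  last first.
  by apply: eq_bigr => k _; rewrite -scaler_suml -mulr_suml ientM.
rewrite [RHS]exchange_big [RHS]sum_midx; apply: eq_bigr => l _.
rewrite [RHS](bigD1 r) //= [X in _ + X]big1 ?addr0 => [|s sr]; last first.
  apply: big1 => k _; rewrite ient_imx midx_last_snoc eq_sym (negPf sr).
  by rewrite mulr0 !mul0r scale0r.
rewrite scaler_sumr; symmetry; rewrite sum_midx sum_midx.
rewrite (bigD1 (midx_init l)) //= [X in _ + X]big1 ?addr0 => [|s sr]; last first.
  apply: big1 => q _; apply: big1 => t _; rewrite ient_braid_last.
  by rewrite !midx_init_snoc eq_sym (negPf sr) !mulr0 mul0r scale0r.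
apply: eq_bigr => q _; rewrite (bigD1 j) //= big1 ?addr0 => [|t tj].
  rewrite ient_imx ient_braid_last !midx_init_snoc !midx_last_snoc !eqxx !mulr1.
  by rewrite -scalerA.
by rewrite midx_last_snoc (negPf tj) mulr0 scale0r.
Qed.

Lemma altern_rec n (x : tp n.+1) :
  altern F (emb x) = (-1) ^+ n *: \sum_j snoc (altern F (ins F j (emb x))) (w_ j).
Proof.
move: x; apply: left_linear_ext => [x y|a x|x y|a x|i].
- by rewrite embD alternD.
- by rewrite emb_lact altern_lact.
- rewrite -scalerDr -big_split; congr (_ *: _); apply: eq_bigr => j _.
  by rewrite embD insD alternD snocDl.
- rewrite lactZr lact_sumr; congr (_ *: _); apply: eq_bigr => j _.
  by rewrite emb_lact ins_lact altern_lact snoc_lact.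
rewrite altern_tbasis wbasisS emb_sum.
transitivity (\sum_j \sum_k (ient (shuffle_mx F n) i k * (midx_last k == j)%:R) *:
   snoc (emb (wbasis F (midx_init k))) (w_ j)).
  rewrite exchange_big; apply: eq_bigr => k _.
  rewrite (bigD1 (midx_last k)) //= big1 ?addr0 => [|j jk].
    by rewrite eqxx mulr1 embZ snoc_emb.
  by rewrite eq_sym (negPf jk) mulr0 scale0r.
rewrite scaler_sumr; apply: eq_bigr => j _.
rewrite ins_tbasis alternZ snocZl scalerA -expr2 sqrr_sign scale1r.
rewrite (morphD_sum alternD) (morphD_sum (snocDl _)); apply: eq_bigr => k _.
by rewrite alternZ snocZl altern_tbasis.
Qed.

(** [ins_j] lowers the degree by one. *)
Lemma ins_homog n j (x : tp n.+1) : exists z : tp n, ins F j (emb x) = emb z.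
Proof.
elim: n j x => [|n IH] j x; elim/(@tpowS_ind _ _ _ _ F): x => [|t u [z Ez] [z' Ez']|x k].
- by exists 0; rewrite !emb0 (morphD0 (@insD _ _ _ _ F j)).
- by exists (z + z'); rewrite !embD insD Ez Ez'.
- exists (x *< lcoord F (w_ k) j).
  rewrite -snoc_emb ins_snoc big1 ?addr0 => [|p _]; first by rewrite sgn_emb scale1r emb_ract.
  by rewrite -/(emb_fun G x) ins_fun (morphD0 (snocDl _)).
- by exists 0; rewrite !emb0 (morphD0 (@insD _ _ _ _ F j)).
- by exists (z + z'); rewrite !embD insD Ez Ez'.
have [z Ez] := choice (fun p => IH p x).
exists ((-1) ^+ n.+1 *: (x *< lcoord F (w_ k) j) +
  \sum_p (z p \oxA cform (f p j) (w_ k) : tp n.+1)).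
rewrite -snoc_emb ins_snoc sgn_emb embD embZ emb_ract ractZl emb_sum.
by congr (_ + _); apply: eq_bigr => p _; rewrite Ez snoc_emb.
Qed.

Lemma altern_ract x a : altern F (x *< a) = altern F x *< a.
Proof.
move: x; apply: tensorfield_additive_ext => [x y|x y|n x].
- by rewrite ractDl alternD.
- by rewrite alternD ractDl.
elim: n x a => [|n IH] x a.
  by rewrite -emb_ract -!/(emb_fun G _) !altern_fun /emb_fun emb_ract.
rewrite -emb_ract !altern_rec ractZl; congr (_ *: _).
rewrite ract_suml emb_ract.
transitivity (\sum_j \sum_p snoc (altern F (ins F p (emb x)))
   (conv (f p j) a >* w_ j)).
  apply: eq_bigr => j _; rewrite ins_ract (morphD_sum alternD) (morphD_sum (snocDl _)).
  apply: eq_bigr => p _; have [z ->] := ins_homog p x.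
  by rewrite IH snoc_bal.
rewrite exchange_big; apply: eq_bigr => p _.
by rewrite -(morphD_sum (snocDr _)) snoc_ract fun_fE.
Qed.

Lemma altern_conv_tens k l x :
  altern F (conv_tens (f k l) x) = conv_tens (f k l) (altern F x).
Proof.
have cD i j := conv_tensD (G := G) (fun_f_functional F i j).
have cZ i j := conv_tensZ (G := G) (fun_f_functional F i j).
move: x; apply: tensorfield_additive_ext => [x y|x y|n x].
- by rewrite cD alternD.
- by rewrite alternD cD.
elim: n k l x => [|n IH] k l x.
  by rewrite -!/(emb_fun G _) altern_fun conv_tens_fun // altern_fun.
rewrite altern_rec cZ (morphD_sum (cD _ _)) conv_tens_emb // altern_rec -conv_tens_emb //.
congr (_ *: _).
transitivity (\sum_q \sum_v snoc (conv_tens (f k v.1) (altern F (ins F v.2 (emb x))))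
  (braid2 F v (q, l) *: w_ q)).
  apply: eq_bigr => q _; rewrite ins_conv_tens (morphD_sum alternD) (morphD_sum (snocDl _)).
  apply: eq_bigr => v _; have [z ->] := ins_homog v.2 x.
  by rewrite alternZ IH snocZl snocZr.
rewrite exchange_big -(pair_bigA _ (fun p j => \sum_q
  snoc (conv_tens (f k p) (altern F (ins F j (emb x))))
  (braid2 F (p, j) (q, l) *: w_ q))) exchange_big.
apply: eq_bigr => j _; rewrite conv_tens_snoc; apply: eq_bigr => p _.
by rewrite cform_omega (morphD_sum (snocDr _)).
Qed.

(** * Contraction and the wedge product *)

(** The contraction with [t_j] on homogeneous tensors, defined without reference
    to coefficients. *)
Definition contr_pow j n : tp n -> T :=
  match n return tp n -> T with
  | 0 => fun _ => 0
  | m.+1 => fun x => emb ((-1) ^+ m *: last_coord j x)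
  end.

(** The contraction with [t_j] on tensorfields. *)
Definition contr j (x : T) : T := dsum_extend (fun n (x : tp n) => contr_pow j x) x.

Let cp_add j n : {morph (fun x : tp n => contr_pow j x) : x y / x + y}.
Proof.
case: n => [|n] x y; first by rewrite /= addr0.
by rewrite /contr_pow last_coordD scalerDr embD.
Qed.

Lemma contr_emb j n (x : tp n) : contr j (emb x) = contr_pow j x.
Proof. exact: (dsum_extend_demb (cp_add j)). Qed.
Lemma contrD j : {morph contr j : x y / x + y}.
Proof. exact: (dsum_extendD (cp_add j)). Qed.
Lemma contr_fun j (a : A) : contr j (emb_fun G a) = 0.
Proof. exact: contr_emb. Qed.
Lemma contr_snoc j x w : contr j (snoc x w) = sgn x *< lcoord F w j.
Proof.
move: x; apply: tensorfield_additive_ext => [x y|x y|n x].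
- by rewrite snocDl contrD.
- by rewrite sgnD ractDl.
by rewrite snoc_emb contr_emb /contr_pow last_coord_pure embZ sgn_emb ractZl emb_ract.
Qed.

Lemma contr_lact j a x : contr j (a >* x) = a >* contr j x.
Proof.
move: x; apply: tensorfield_additive_ext => [x y|x y|n x].
- by rewrite lactDr contrD.
- by rewrite contrD lactDr.
rewrite -emb_lact !contr_emb; case: n x => [|n] x; first by rewrite lactr0.
by rewrite /contr_pow last_coord_lact !embZ emb_lact lactZr.
Qed.

Lemma contr_ract j x a : contr j (x *< a) = \sum_p contr p x *< conv (f p j) a.
Proof.
elim/(@tensorfield_ind _ _ _ _ F): x => [x y IHx IHy|b|x i _].
- rewrite ractDl !contrD IHx IHy -big_split; apply: eq_bigr => p _.
  by rewrite contrD ractDl.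
- rewrite /emb_fun -emb_ract contr_fun big1 // => p _.
  by rewrite contr_fun ractl0.
rewrite snoc_ract contr_snoc lcoord_ract ract_sumr; apply: eq_bigr => p _.
by rewrite contr_snoc ractA.
Qed.

(** The sign and the sum in [altern_rec] disappear: contraction picks the
    [omega^j] term and restores the sign. *)
Lemma contr_altern j x : contr j (altern F x) = altern F (ins F j x).
Proof.
move: x; apply: tensorfield_additive_ext => [x y|x y|n x].
- by rewrite alternD contrD.
- by rewrite insD alternD.
case: n x => [|n] x.
  by rewrite -!/(emb_fun G _) altern_fun contr_fun ins_fun altern0.
rewrite altern_rec -lactK contr_lact lactK (morphD_sum (@contrD j)).
rewrite (bigD1 j) //= big1 ?addr0 => [|i ij].
  rewrite contr_snoc lcoord_omega eqxx ract1; have [z ->] := ins_homog j x.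
  by rewrite altern_emb sgn_emb scalerA -expr2 sqrr_sign scale1r.
by rewrite contr_snoc lcoord_omega (negPf ij) ractr0.
Qed.

Lemma tens_mul_lact a (x y : T) : tens_mul (a >* x) y = a >* tens_mul x y.
Proof.
elim/(@tensorfield_ind _ _ _ _ F): y => [y z IHy IHz|b|y j IH].
- by rewrite !tens_mulDr IHy IHz lactDr.
- by rewrite !tens_mul_fun lractA.
- by rewrite !tens_mul_snoc IH snoc_lact.
Qed.

(** The kernel of [altern] is a two-sided ideal, by induction on the total
    degree [d].  If [altern] kills [s] it kills [ins_i s], by [contr_altern], and
    likewise for [t]; so each term of [ins_j (s t)] has a factor in the kernel
    and total degree [d-1]. *)
Lemma altern_ker_homog d m n (s : tp m) (t : tp n) : (n + m = d)%N ->
  altern F (emb s) = 0 \/ altern F (emb t) = 0 ->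
  altern F (tens_mul (emb s) (emb t)) = 0.
Proof.
elim: d m n s t => [|d IH] m n s t Ed.
  case: m s Ed => [|m] s; last by rewrite addnS.
  case: n t => [|n] t // _.
  rewrite -!/(emb_fun G _) !altern_fun tens_mul_fun => -[->|E].
    by rewrite ractl0 altern0.
  have -> : t = 0 by apply: (@emb_inj _ _ G 0); rewrite emb0.
  by rewrite ractr0 altern0.
move=> st0.
have Hrec k (x : tp k) : k = d.+1 -> (forall j, altern F (ins F j (emb x)) = 0) ->
    altern F (emb x) = 0.
  move=> ek; move: x; rewrite ek => x Hx; rewrite altern_rec big1 ?scaler0 // => j _.
  by rewrite Hx (morphD0 (snocDl _)).
rewrite tens_mul_emb; apply: (Hrec _ _ Ed) => j.
have Z i y : altern F y = 0 -> altern F (ins F i y) = 0.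
  by rewrite -contr_altern => ->; exact: (morphD0 (@contrD i)).
rewrite -tens_mul_emb ins_tens_mul alternD (morphD_sum alternD) big1 ?add0r => [|i _].
  rewrite sgn_emb -lactK; case: n t Ed st0 => [|n] t Ed st0.
    by rewrite -/(emb_fun G t) ins_fun tens_mul0r altern0.
  have [z Ez] := ins_homog j t; rewrite Ez -emb_lact.
  apply: IH; first by move: Ed => [].
  case: st0 => [s0|t0]; first by left; rewrite emb_lact altern_lact s0 lactr0.
  by right; rewrite -Ez Z.
case: m s Ed st0 => [|m] s Ed st0.
  by rewrite -/(emb_fun G s) ins_fun tens_mul0l altern0.
have [z Ez] := ins_homog i s; rewrite Ez conv_tens_emb //.
apply: IH; first by move: Ed; rewrite addnS => -[].
case: st0 => [s0|t0]; [left|right]; first by rewrite -Ez Z.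
rewrite -conv_tens_emb // altern_conv_tens t0.
exact: (morphD0 (conv_tensD (fun_f_functional F _ _))).
Qed.

Lemma altern_homog0 x n : altern F x = 0 -> altern F (emb (x n)) = 0.
Proof.
have H y : altern F (emb ((y : T) n)) = emb (altern F y n).
  move: y; apply: tensorfield_additive_ext => [x' y|x' y|m y].
  - by rewrite dvalD embD alternD.
  - by rewrite alternD dvalD embD.
  have [<-|mn] := eqVneq m n; first by rewrite emb_val (altern_emb y) emb_val.
  rewrite (altern_emb y) !demb_neq // emb0 altern0; by [].
by rewrite H => ->; rewrite emb0.
Qed.

Lemma tensorfield_decomp (x : T) : exists b, x = \sum_(n < b) emb (x n).
Proof. by have [b xb] := dvalP x; exists b; apply: dsum_decomp. Qed.

Lemma altern_ker_l x y : altern F x = 0 -> altern F (tens_mul x y) = 0.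
Proof.
move=> x0; have [b ->] := tensorfield_decomp x; have [c ->] := tensorfield_decomp y.
rewrite (morphD_sum (tens_mulDl _)) (morphD_sum alternD); apply: big1 => m _.
rewrite (morphD_sum (tens_mulDr _)) (morphD_sum alternD); apply: big1 => n _.
by apply: (altern_ker_homog (erefl _)); left; apply: altern_homog0.
Qed.

Lemma altern_ker_r x y : altern F y = 0 -> altern F (tens_mul x y) = 0.
Proof.
move=> y0; have [b ->] := tensorfield_decomp x; have [c ->] := tensorfield_decomp y.
rewrite (morphD_sum (tens_mulDl _)) (morphD_sum alternD); apply: big1 => m _.
rewrite (morphD_sum (tens_mulDr _)) (morphD_sum alternD); apply: big1 => n _.
by apply: (altern_ker_homog (erefl _)); right; apply: altern_homog0.
Qed.

Lemma unalternK x : altern F (unaltern F (altern F x)) = altern F x.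
Proof.
exact: (@xgetPex _ 0 [set s | altern F s = altern F x]%classic (ex_intro _ x erefl)).
Qed.

Lemma wedge_altern x y : wedge F (altern F x) (altern F y) = altern F (tens_mul x y).
Proof.
rewrite /wedge; set s := unaltern _ _; set t := unaltern _ _.
have sx : altern F (s - x) = 0 by rewrite (morphDB alternD) unalternK subrr.
have ty : altern F (t - y) = 0 by rewrite (morphDB alternD) unalternK subrr.
have := altern_ker_l t sx; rewrite (morphDB (tens_mulDl _)) (morphDB alternD).
move/eqP; rewrite subr_eq0 => /eqP ->.
have := altern_ker_r x ty; rewrite (morphDB (tens_mulDr _)) (morphDB alternD).
by move/eqP; rewrite subr_eq0 => /eqP.
Qed.

Lemma exterior_altern n (x : tp n) : exterior F x -> exists s : tp n, emb x = altern F (emb s).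
Proof.
case=> a ->; exists (\sum_i a i >* tb i).
rewrite altern_emb; congr (emb _); apply: eq_bigr => i _.
by rewrite tcoef_sum.
Qed.

(** Write [omega^k] as a sum of [a db]: then the sum of the [a V(b)] is the
    coefficient of [V] at [k]. *)
Lemma vectorfield_inj (b b' : {ffun 'I_N -> A}) :
  vectorfield F b = vectorfield F b' -> b = b'.
Proof.
move=> E; apply/ffunP => k; have [s Es] := dif_gen (w_ k).
have H (c : {ffun 'I_N -> A}) : \sum_(p <- s) p.1 * vectorfield F c p.2 = c k.
  have := congr1 (fun w => lcoord F w) Es.
  transitivity (\sum_i lcoord F (w_ k) i * c i).
    rewrite Es; under [in RHS]eq_bigr do rewrite (morphD_sum (lcoordD F _)) mulr_suml.
    rewrite exchange_big; apply: eq_bigr => p _.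
    rewrite /vectorfield mulr_sumr; apply: eq_bigr => i _.
    by rewrite lcoord_lact (chiE F) lcoord_sum mulrA.
  rewrite (bigD1 k) //= big1 ?addr0 => [|i ik].
    by rewrite lcoord_omega eqxx mul1r.
  by rewrite lcoord_omega eq_sym (negPf ik) mul0r.
by rewrite -H E H.
Qed.

Lemma vcoefK (b : {ffun 'I_N -> A}) : vcoef F (vectorfield F b) = b.
Proof.
apply/esym/vectorfield_inj.
exact: (@xgetPex _ 0 [set c | vectorfield F b = vectorfield F c]%classic
  (ex_intro _ b erefl)).
Qed.

Lemma tvec_vectorfield j : tvec F j = vectorfield F [ffun i => (i == j)%:R].
Proof.
apply/funext => a; rewrite /vectorfield (bigD1 j) //= ffunE eqxx mulr1.
by rewrite big1 ?addr0 // => i /negPf ij; rewrite ffunE ij mulr0.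
Qed.

Lemma contractE V x : contract F V x = \sum_j contr j x *< vcoef F V j.
Proof.
have cD n : {morph (fun x : tp n => match n return tp n -> T with
    | 0 => fun _ => 0
    | m.+1 => fun x => emb (contract_pow F V x) end x) : x y / x + y}.
  case: n => [|n] y z; first by rewrite addr0.
  rewrite -embD -scalerDr -big_split; congr (emb (_ *: _)).
  by apply: eq_bigr => i _; rewrite tcoefD lactDl ractDl.
move: x; apply: tensorfield_additive_ext => [x y|x y|n x].
- exact: (dsum_extendD cD).
- by rewrite -big_split; apply: eq_bigr => j _; rewrite contrD ractDl.
rewrite [LHS](dsum_extend_demb cD x).
case: n x => [|n] x.
  by rewrite big1 // => j _; rewrite -/(emb_fun G x) contr_fun ractl0.
under eq_bigr do rewrite contr_emb /contr_pow -emb_ract ractZl.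
rewrite -emb_sum -scaler_sumr; congr (emb (_ *: _)).
rewrite [in RHS](tcoefE x).
under [in RHS]eq_bigr do rewrite (morphD_sum (@last_coordD n _)) ract_suml.
rewrite exchange_big; apply: eq_bigr => i _.
rewrite (bigD1 (midx_last i)) //= big1 ?addr0 => [|j ji].
  by rewrite last_coord_lact last_coord_tbasis eqxx scale1r.
by rewrite last_coord_lact last_coord_tbasis eq_sym (negPf ji) scale0r lactr0 ractl0.
Qed.

Lemma contract_tvec j x : contract F (tvec F j) x = contr j x.
Proof.
rewrite contractE tvec_vectorfield vcoefK (bigD1 j) //= big1 ?addr0 => [|i ij].
  by rewrite ffunE eqxx ract1.
by rewrite ffunE (negPf ij) ractr0.
Qed.

Lemma contract_vectorfield b x :
  contract F (vectorfield F b) x = \sum_j contr j x *< b j.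
Proof. by rewrite contractE vcoefK. Qed.

(** Property (d') for exterior forms written as antisymmetrized tensors. *)
Lemma contract_wedge b m n (s : tp m) (t : tp n) :
  contract F (vectorfield F b) (wedge F (altern F (emb s)) (altern F (emb t))) =
    (\sum_j \sum_i wedge F (contr j (altern F (emb s)))
         (conv_tens (f j i) (altern F (emb t))) *< b i)
    + (-1) ^+ m *: wedge F (altern F (emb s))
        (contract F (vectorfield F b) (altern F (emb t))).
Proof.
rewrite wedge_altern !contract_vectorfield.
under eq_bigr do rewrite contr_altern ins_tens_mul alternD ractDl
  (morphD_sum alternD) ract_suml.
rewrite big_split /= exchange_big; congr (_ + _).
  apply: eq_bigr => j _; apply: eq_bigr => i _.
  by rewrite contr_altern -altern_conv_tens wedge_altern.
under [in RHS]eq_bigr do rewrite contr_altern -altern_ract.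
rewrite -(morphD_sum alternD) wedge_altern (morphD_sum (tens_mulDr _)).
rewrite (morphD_sum alternD) scaler_sumr; apply: eq_bigr => j _.
rewrite tens_mul_ract altern_ract sgn_emb -[in LHS]lactK tens_mul_lact.
by rewrite altern_lact lactK ractZl.
Qed.

End Coordinates.

Theorem theorem2p4p7 (R : realType) (A : hopfAlgType R[i])
    (G : bicov_calculus A) (N : nat) (F : frame G N)
    (V : A -> A) (b : {ffun 'I_N -> A}) (hV : V = vectorfield F b) :
  (* (a') *)
  (forall theta : tensorfield G,
     contract F V theta = \sum_j contract F (tvec F j) theta *< b j) /\
  (* (b') *)
  (forall a : A, contract F V (emb_fun G a) = 0) /\
  (* (c') *)
  (forall j : 'I_N, contract F V (emb_form (omega F j)) = emb_fun G (b j)) /\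
  (* (d') *)
  (forall (m n : nat) (theta : tpow G m) (theta' : tpow G n),
     exterior F theta -> exterior F theta' ->
     contract F V (wedge F (emb theta) (emb theta')) =
       (\sum_j \sum_i
          wedge F (contract F (tvec F j) (emb theta))
                  (conv_tens (fun_f F j i) (emb theta')) *< b i)
       + (-1) ^+ m *: wedge F (emb theta) (contract F V (emb theta'))) /\
  (* (e') *)
  (forall (a : A) (theta theta' : tensorfield G),
     contract F V (a >* theta + theta') =
       a >* contract F V theta + contract F V theta') /\
  (* (f') *)
  (forall (a : A) (theta : tensorfield G),
     contract F V (theta *< a) =
       \sum_j \sum_i
          contract F (tvec F j) theta *< conv (fun_f F j i) a *< b i) /\
  (* (g') *)
  (forall (lambda : R[i]) (theta : tensorfield G),
     contract F (fun a => lambda *: V a) theta = lambda *: contract F V theta).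
Proof.
rewrite {}hV; split; [|split; [|split; [|split; [|split; [|split]]]]].
- by move=> x; rewrite contract_vectorfield; under [RHS]eq_bigr do rewrite contract_tvec.
- by move=> a; rewrite contractE big1 // => j _; rewrite contr_fun ractl0.
- move=> j; rewrite contract_vectorfield (bigD1 j) //= big1 ?addr0 => [|i ij].
    rewrite /emb_form -snoc_emb contr_snoc lcoord_omega eqxx ract1 sgn_emb scale1r.
    by rewrite -emb_ract; congr (emb _); apply: mul1r.
  by rewrite /emb_form -snoc_emb contr_snoc lcoord_omega eq_sym (negPf ij) ractr0 ractl0.
- move=> m n x y /exterior_altern[s ->] /exterior_altern[t ->].
  rewrite contract_wedge; congr (_ + _).
  by apply: eq_bigr => j _; apply: eq_bigr => i _; rewrite contract_tvec.
- move=> a x y; rewrite !contract_vectorfield lact_sumr -big_split.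
  by apply: eq_bigr => j _; rewrite contrD contr_lact ractDl lractA.
- move=> a x; rewrite contract_vectorfield.
  under eq_bigr do rewrite contr_ract ract_suml.
  rewrite exchange_big; apply: eq_bigr => j _; apply: eq_bigr => i _.
  by rewrite contract_tvec.
move=> k x; have -> : (fun a => k *: vectorfield F b a) =
    vectorfield F [ffun i => k *: b i].
  apply/funext => a; rewrite scaler_sumr; apply: eq_bigr => i _.
  by rewrite ffunE scalerAr.
rewrite !contract_vectorfield scaler_sumr; apply: eq_bigr => j _.
by rewrite ffunE ractZr.
Qed.
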